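(* Let $D$ be an ADDB-domain with quotient field $K$, and let $A$ be a $D$-algebra that is torsion-free and finitely generated as a $D$-module, and such that $A\cap K=D$. Suppose that $\mathrm{Int}_K(A)_P=\mathrm{Int}_K(A_P)$ for all prime ideals $P$ of $D$. If $\mathrm{Int}_K(A)$ is integrally closed, then $\mathrm{Int}_K(A)$ is a Prüfer domain.
   Context: Algebras are associative and unital, not necessarily commutative. $K$ and $A$ are embedded in $B=A\otimes_D K=(D\setminus\{0\})^{-1}A$ via $k\mapsto 1\otimes k$ and $a\mapsto a\otimes 1$; $A\cap K=D$ is meant inside $B$. ADDB-domain: an integral domain $D$, not a field, is an almost Dedekind domain if $D_M$ is a discrete valuation ring for each maximal ideal $M$. Let $D$ be almost Dedekind with all residue fields finite. Then $D$ contains a principal ideal domain $D_0$, where $D_0\cong\mathbb{Z}$ if $\mathrm{char}(K)=0$, and $D_0\cong F[t]$ (polynomial ring in one variable over the prime field $F$ with $\mathrm{char}(K)$ elements) if $\mathrm{char}(K)>0$. For a nonzero prime element $p$ of $D_0$ and a prime $P$ of $D$ above $p$ (i.e. $P\cap D_0=pD_0$), let $e_{P,p}=v_P(p)$, with $v_P$ the normalized $P$-adic valuation on $K$, and $f_{P,p}=[D/P:D_0/pD_0]$. $D$ satisfies the double-boundedness condition if, for each $p$, the sets $\{e_{P,p}\}$ and $\{f_{P,p}\}$ ($P$ ranging over the primes of $D$ above $p$) are both bounded. $D$ is an ADDB-domain if it is an almost Dedekind domain with finite residue fields satisfying the double-boundedness condition. $\mathrm{Int}_K(A)=\{f\in K[X]\mid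 f(A)\subseteq A\}$. For a prime ideal $P$ of $D$ and a $D$-module $M$, $M_P=(D\setminus P)^{-1}M$; $\mathrm{Int}_K(A_P)=\{f\in K[X]\mid f(A_P)\subseteq A_P\}$, with $A_P\subseteq B$. *)

(* Defs.v *)
From HB Require Import structures.
From mathcomp Require Import all_boot all_order all_algebra.
From mathcomp Require Import ring_quotient.
From mathcomp Require Import boolp classical_sets cardinality.

Set Implicit Arguments.
Unset Strict Implicit.
Unset Printing Implicit Defensive.

Import Order.TTheory GRing.Theory Num.Theory.
Local Open Scope ring_scope.
Local Open Scope classical_set_scope.
Local Open Scope quotient_scope.

Notation tofrac := (@FracField.tofrac _).
Notation "x %:F" := (@FracField.tofrac _ x) : ring_scope.

(* The localization at P of a D-submodule M of a K-vector space, K = Frac D,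
   taken inside that space: { m / s | m in M, s in D \ P }. *)
Definition localize (D : idomainType) (P : {pred D})
    (V : lmodType {fraction D}) (M : set V) : set V :=
  [set v | exists s m, [/\ s \notin P, M m & v = s%:F^-1 *: m]].

Definition local_ring (D : idomainType) (P : {pred D}) : set {fraction D} :=
  localize P (range tofrac : set {fraction D}^o).

(* The value of v at 0 (morally +oo) is irrelevant. *)
Definition normalized_valuation (F : fieldType) (v : F -> int) : Prop :=
  [/\ forall x y, x != 0 -> y != 0 -> v (x * y) = v x + v y,
      forall x y, x != 0 -> y != 0 -> x + y != 0 ->
        Num.min (v x) (v y) <= v (x + y)
    & exists2 x, x != 0 & v x = 1].

Definition valuation_ring_of (F : fieldType) (v : F -> int) : set F :=
  [set x | x = 0 \/ 0 <= v x].

Definition dvr (F : fieldType) (O : set F) : Prop :=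
  exists2 v, normalized_valuation v & O = valuation_ring_of v.

(* [idealr D] is the library's type of proper ideals of D. *)
Definition maximal_ideal (D : idomainType) (M : idealr D) : Prop :=
  forall J : idealr D, {subset M <= J} -> {subset J <= M}.

Definition almost_dedekind (D : idomainType) : Prop :=
  (exists2 x : D, x != 0 & x \isn't a GRing.unit) /\
  (forall M : idealr D, maximal_ideal M -> dvr (local_ring M)).

Definition finite_residue_fields (D : idomainType) : Prop :=
  forall M : idealr D, maximal_ideal M -> finite_set [set: {ideal_quot M}].

Definition divides (R : idomainType) (a b : R) : Prop := exists c, b = c * a.

Definition prime_element (R : idomainType) (p : R) : Prop :=
  [/\ p != 0, p \isn't a GRing.unit
    & forall a b, divides p (a * b) -> divides p a \/ divides p b].

Section DoubleBoundedness.
Variables (D D0 : idomainType) (phi : {rmorphism D0 -> D}).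

Definition lies_above (P : prime_idealr D) (p : D0) : Prop :=
  forall c : D0, phi c \in P <-> divides p c.

Definition adic_valuation (P : prime_idealr D) (v : {fraction D} -> int) :=
  normalized_valuation v /\ local_ring P = valuation_ring_of v.

(* e_{P,p} = e *)
Definition ramification_index (P : prime_idealr D) (p : D0) (e : int) : Prop :=
  exists2 v, adic_valuation P v & v (phi p)%:F = e.

(* f_{P,p} = n: D/P has a basis of n elements over D0/pD0, whose elements
   are represented by elements of D0. *)
Definition residue_degree (P : prime_idealr D) (p : D0) (n : nat) : Prop :=
  exists b : 'I_n -> {ideal_quot P},
    (forall y : {ideal_quot P}, exists c : 'I_n -> D0,
        y = \sum_(i < n) \pi_{ideal_quot P} (phi (c i)) * b i) /\
    (forall c : 'I_n -> D0,
        \sum_(i < n) \pi_{ideal_quot P} (phi (c i)) * b i = 0 ->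
        forall i, divides p (c i)).

Definition doubly_bounded_over : Prop :=
  forall p : D0, prime_element p ->
    (exists N : int, forall (P : prime_idealr D) (e : int),
        lies_above P p -> ramification_index P p e -> e <= N) /\
    (exists N : nat, forall (P : prime_idealr D) (n : nat),
        lies_above P p -> residue_degree P p n -> (n <= N)%N).

End DoubleBoundedness.

(* In positive characteristic q, a copy of F_q[t] in D is not canonical; the
   condition is required for some copy. *)
Definition doubly_bounded (D : idomainType) : Prop :=
  ([pchar {fraction D}] =i pred0 /\
     exists phi : {rmorphism int -> D}, injective phi /\ doubly_bounded_over phi)
  \/
  (exists2 q : nat, q \in [pchar {fraction D}] &
     exists phi : {rmorphism {poly 'F_q} -> D},
       injective phi /\ doubly_bounded_over phi).

Definition ADDB_domain (D : idomainType) : Prop :=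
  [/\ almost_dedekind D, finite_residue_fields D & doubly_bounded D].

Definition torsion_free (D : idomainType) (V : lmodType D) : Prop :=
  forall (d : D) (x : V), d *: x = 0 -> d = 0 \/ x = 0.

Definition finitely_generated (D : idomainType) (V : lmodType D) : Prop :=
  exists (n : nat) (g : 'I_n -> V), forall x : V,
    exists c : 'I_n -> D, x = \sum_(i < n) c i *: g i.

(* iota exhibits the K-algebra B as (D \ {0})^-1 A, that is as the tensor
   product of A and K over D. *)
Definition is_scalar_localization (D : idomainType) (A : algType D)
    (B : algType {fraction D}) (iota : {rmorphism A -> B}) : Prop :=
  [/\ forall (d : D) (a : A), iota (d *: a) = d%:F *: iota a,
      forall a : A, iota a = 0 <-> exists2 d : D, d != 0 & d *: a = 0
    & forall b : B, exists (d : D) (a : A), d != 0 /\ b = d%:F^-1 *: iota a].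

Definition IntK (K : fieldType) (B : algType K) (S : set B) : set {poly K} :=
  [set f | forall b, S b -> S (horner_alg b f)].

Section IntRing.
Variables (D : idomainType) (A : algType D) (B : algType {fraction D}).
Variable iota : {rmorphism A -> B}.
Local Notation K := {fraction D}.

Definition IntK_pred : {pred {poly K}} := fun f => f \in IntK (range iota).

Lemma IntK_predP f :
  reflect (forall a, exists a', iota a' = horner_alg (iota a) f)
          (f \in IntK_pred).
Proof.
apply: (iffP idP) => [|fP].
  move=> /set_mem fP a; have Sa : range iota (iota a) by exists a.
  by have [a' _ aE] := fP _ Sa; exists a'.
by apply/mem_set => _ [a _ <-]; have [a' <-] := fP a; exists a'.
Qed.

Fact IntK_subring : subring_closed IntK_pred.
Proof.
split=> [|f g /IntK_predP fP /IntK_predP gP|f g /IntK_predP fP /IntK_predP gP].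
- by apply/IntK_predP => a; exists 1; rewrite !rmorph1.
- apply/IntK_predP => a; have [[x xE] [y yE]] := (fP a, gP a).
  by exists (x - y); rewrite !rmorphB xE yE.
- apply/IntK_predP => a; have [[x xE] [y yE]] := (fP a, gP a).
  by exists (x * y); rewrite !rmorphM xE yE.
Qed.

HB.instance Definition _ :=
  GRing.isSubringClosed.Build {poly K} IntK_pred IntK_subring.

(* Int_K(A) as a ring. *)
Record IntK_ring := MkIntK {
  IntK_val : {poly K};
  IntK_valP : IntK_val \in IntK_pred }.

HB.instance Definition _ := [isSub for IntK_val].
HB.instance Definition _ := [Choice of IntK_ring by <:].
HB.instance Definition _ := [SubChoice_isSubComNzRing of IntK_ring by <:].

Definition IntK_unit : {pred IntK_ring} :=
  fun f => (val f \is a GRing.unit) && ((val f)^-1 \in IntK_pred).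
Definition IntK_inv (f : IntK_ring) : IntK_ring :=
  if f \in IntK_unit then insubd f (val f)^-1 else f.

Fact IntK_mulVr : {in IntK_unit, left_inverse 1 IntK_inv *%R}.
Proof.
move=> f fU; rewrite /IntK_inv fU; have /andP[uf If] := fU.
by apply: val_inj; rewrite rmorphM /= val_insubd If mulVr ?rmorph1.
Qed.

Fact IntK_unitP (f g : IntK_ring) : g * f = 1 -> f \in IntK_unit.
Proof.
move=> /(congr1 val); rewrite rmorphM rmorph1 /= => gf1.
have uf : val f \is a GRing.unit by apply/unitrPr; exists (val g); rewrite mulrC.
have fV : (val f)^-1 = val g by rewrite -[LHS]mul1r -gf1 mulrK.
by apply/andP; split=> //; rewrite fV; exact: valP.
Qed.

Fact IntK_inv_out : {in [predC IntK_unit], IntK_inv =1 id}.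
Proof. by move=> f /negbTE fU; rewrite /IntK_inv fU. Qed.

HB.instance Definition _ := GRing.ComNzRing_hasMulInverse.Build IntK_ring
  IntK_mulVr IntK_unitP IntK_inv_out.

Fact IntK_integral (f g : IntK_ring) : f * g = 0 -> (f == 0) || (g == 0).
Proof.
move=> /(congr1 val); rewrite rmorphM rmorph0 /= => /eqP.
by rewrite mulf_eq0 -[0](rmorph0 (val : IntK_ring -> _)) !(inj_eq val_inj).
Qed.

HB.instance Definition _ :=
  GRing.ComUnitRing_isIntegral.Build IntK_ring IntK_integral.

End IntRing.

Definition integrally_closed (R : idomainType) : Prop :=
  forall x : {fraction R}, integralOver tofrac x -> exists r : R, x = r%:F.

Section Prufer.
Variable R : idomainType.
Local Notation Q := {fraction R}.

Definition fractional_ideal (J : set Q) : Prop :=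
  [/\ J 0, forall x y, J x -> J y -> J (x + y),
      forall (r : R) x, J x -> J (r%:F * x)
    & exists2 d : R, d != 0 & forall x, J x -> range tofrac (d%:F * x)].

Definition ideal_mul (I J : set Q) : set Q :=
  [set x | exists (n : nat) (u v : 'I_n -> Q),
     [/\ forall i, I (u i), forall i, J (v i) & x = \sum_(i < n) u i * v i]].

Definition invertible_ideal (I : set Q) : Prop :=
  exists2 J, fractional_ideal J & ideal_mul I J = range tofrac.

Definition ideal_gen (n : nat) (g : 'I_n -> R) : set Q :=
  [set x | exists c : 'I_n -> R, x = (\sum_(i < n) c i * g i)%:F].

Definition prufer_domain : Prop :=
  forall (n : nat) (g : 'I_n -> R), (exists i, g i != 0) ->
    invertible_ideal (ideal_gen g).

End Prufer.

(* Main.v *)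
Require Import Defs.
From mathcomp Require Import all_boot all_order all_algebra.
From mathcomp Require Import ring_quotient.
From mathcomp Require Import boolp classical_sets.
From HB Require Import structures.
From mathcomp Require Import all_field cardinality zify ring.

(* Fix a maximal ideal M of D and put V = D_M, a discrete valuation ring with
   uniformizer pi and finite residue field. Every element of A_M acts on the n
   generators of A through a matrix with entries in V.

   (1) As Int_K(A) is integrally closed, a polynomial f that takes integral
   values at all integral points of degree at most n, in all valuation rings O
   prolonging V, lies in Int_K(A)_M. Indeed, if C is the matrix of b in A_M,
   the eigenvalues of f(C) are the values of f at eigenvalues of C, so that
   the characteristic polynomial of f(C) has coefficients in V; it kills f(b).
   If Phi is the product of all monic polynomials of degree n over V / pi, a
   power of Phi therefore sends each f(b) into A_M, and f is integral over
   Int_K(A_M) = Int_K(A)_M.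

   (2) Ramification indices and residue degrees at points of degree at most n
   are at most n, so there is N such that y^N is pi^l times a 1-unit for all
   nonzero values y. Given coprime g_i, a suitable form w in the g_i, of
   degree divisible by N, has the value of a power of the g_i of least value
   and is pi^l times a 1-unit with l bounded; a polynomial E with E(0) = 1
   makes E(w) small at every point, and 1 - E(w) = w W gives Y_i with sum Y_i
   g_i = 1 and all Y_i g_j integral.

   (3) By (1) some s outside M satisfies s Y_i g_j in Int_K(A) for all i, j.
   Letting M vary, such s generate the unit ideal of D, and the resulting Y_i
   generate the inverse of the ideal generated by the g_i. *)

Import Order.TTheory GRing.Theory Num.Theory.

Local Open Scope ring_scope.
Local Open Scope classical_set_scope.

Set Implicit Arguments.
Unset Strict Implicit.
Unset Printing Implicit Defensive.

(** * Valuation rings of a field *)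

HB.mixin Record isValuationRing (L : fieldType) (O : L -> bool) := {
  valring_total : forall x, (x \in O) || (x^-1 \in O)
}.

#[short(type="valuationRing")]
HB.structure Definition ValuationRing (L : fieldType) :=
  {O of GRing.SubringClosed L O & isValuationRing L O}.

Arguments valring_total {L} s x.

Definition max_ideal (L : fieldType) (O : {pred L}) : {pred L} :=
  [pred x | (x == 0) || (x^-1 \notin O)].

Definition val_unit (L : fieldType) (O : {pred L}) : {pred L} :=
  [pred x | (x \in O) && (x \notin max_ideal O)].

Definition one_unit (L : fieldType) (O : {pred L}) : {pred L} :=
  [pred x | x - 1 \in max_ideal O].

Section ValuationRingTheory.
Variables (L : fieldType) (O : valuationRing L).
Implicit Types x y : L.

Lemma max_idealE x : (x \in max_ideal O) = (x == 0) || (x^-1 \notin O).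
Proof. by []. Qed.

Lemma val_unitE x : (x \in val_unit O) = (x \in O) && (x \notin max_ideal O).
Proof. by []. Qed.

Lemma one_unitE x : (x \in one_unit O) = (x - 1 \in max_ideal O).
Proof. by []. Qed.

Lemma max_ideal1 : (1 \in max_ideal O) = false.
Proof. by rewrite max_idealE oner_eq0 invr1 rpred1. Qed.

Lemma max_ideal_sub : {subset max_ideal O <= O}.
Proof.
move=> x; rewrite max_idealE => /orP[/eqP->|]; first exact: rpred0.
by have /orP[//|->] := valring_total O x.
Qed.

Lemma max_idealMr x y : x \in max_ideal O -> y \in O -> x * y \in max_ideal O.
Proof.
rewrite !max_idealE => /orP[/eqP->|xO] yO; first by rewrite mul0r eqxx.
case: eqVneq => //=; rewrite mulf_eq0 negb_or => /andP[x0 y0].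
apply: contra xO => xyO.
have -> : x^-1 = y * (x * y)^-1 by field; rewrite x0 y0.
exact: rpredM.
Qed.

Lemma max_idealMl x y : x \in O -> y \in max_ideal O -> x * y \in max_ideal O.
Proof. by move=> xO ym; rewrite mulrC max_idealMr. Qed.

Fact max_ideal_zmod_closed : zmod_closed (max_ideal O).
Proof.
have sub_div x y : x / y \in O -> x \in max_ideal O -> y \in max_ideal O ->
    x - y \in max_ideal O.
  have [->|y0] := eqVneq y 0; first by rewrite subr0.
  move=> xyO _ ym; have -> : x - y = y * (x / y - 1) by field.
  by rewrite max_idealMr ?rpredB ?rpred1.
have oppm x : x \in max_ideal O -> - x \in max_ideal O.
  by move=> xm; rewrite -mulrN1 max_idealMr ?rpredN1.
split=> [|x y xm ym]; first by rewrite max_idealE eqxx.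
have /orP[xyO|] := valring_total O (x / y); first exact: sub_div.
by rewrite invf_div -opprB => yxO; apply/oppm/sub_div.
Qed.

HB.instance Definition _ :=
  GRing.isZmodClosed.Build L (max_ideal O) max_ideal_zmod_closed.

Lemma max_idealX n x : x \in max_ideal O -> (0 < n)%N -> x ^+ n \in max_ideal O.
Proof.
by case: n => // n xm _; rewrite exprS max_idealMr ?rpredX ?max_ideal_sub.
Qed.

Lemma val_unitP x :
  reflect [/\ x != 0, x \in O & x^-1 \in O] (x \in val_unit O).
Proof.
by rewrite val_unitE max_idealE negb_or negbK; apply: (iffP and3P) => -[].
Qed.

Fact val_unit_divr_closed : divr_closed (val_unit O).
Proof.
split=> [|x y /val_unitP[x0 xO xVO] /val_unitP[y0 yO yVO]].
  by rewrite val_unitE rpred1 max_ideal1.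
by apply/val_unitP; rewrite mulf_neq0 ?invr_eq0 // invf_div !rpredM.
Qed.

HB.instance Definition _ :=
  GRing.isDivClosed.Build L (val_unit O) val_unit_divr_closed.

Lemma val_unit_sub : {subset val_unit O <= O}.
Proof. by move=> x /andP[]. Qed.

Lemma val_unit_neq0 x : x \in val_unit O -> x != 0.
Proof. by case/val_unitP. Qed.

Lemma one_unit_val_unit : {subset one_unit O <= val_unit O}.
Proof.
move=> x; rewrite one_unitE => xm; have xO : x \in O.
  by rewrite -(subrK 1 x) rpredD ?rpred1 ?max_ideal_sub.
rewrite val_unitE xO; apply/negP => x1m.
by have := rpredB x1m xm; rewrite subKr max_ideal1.
Qed.

Lemma one_unit_sub : {subset one_unit O <= O}.
Proof. by move=> x /one_unit_val_unit /val_unit_sub. Qed.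

Lemma one_unit_neq0 x : x \in one_unit O -> x != 0.
Proof. by move=> /one_unit_val_unit /val_unit_neq0. Qed.

Fact one_unit_divr_closed : divr_closed (one_unit O).
Proof.
split=> [|x y xu yu]; first by rewrite one_unitE subrr rpred0.
have /val_unitP[y0 _ yVO] := one_unit_val_unit yu.
move: xu yu; rewrite !one_unitE => xm ym.
have -> : x / y - 1 = (x - 1 - (y - 1)) / y by field.
exact: max_idealMr (rpredB xm ym) yVO.
Qed.

HB.instance Definition _ :=
  GRing.isDivClosed.Build L (one_unit O) one_unit_divr_closed.

Lemma dominant_term (I : finType) (t : I -> L) i : t i != 0 ->
  exists2 j, t j != 0 & forall k, t k / t j \in O.
Proof.
move=> ti; pose ord x y := (y == 0) || ((x != 0) && (y / x \in O)).
have ord_refl : reflexive ord.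
  by move=> x; rewrite /ord; case: eqVneq => //= x0; rewrite divff ?rpred1.
have ord_trans : transitive ord.
  move=> y x z; rewrite /ord => /orP[/eqP->|/andP[x0 yx]].
    by rewrite eqxx /= orbF => ->.
  case: (z == 0) => //= /andP[y0 zy]; rewrite x0.
  by have -> : z / x = z / y * (y / x); [rewrite mulrA divfK|rewrite rpredM].
have ord_total : total ord.
  move=> x y; rewrite /ord; have [->|x0] := eqVneq x 0; first by rewrite orbT.
  have [->|y0] //= := eqVneq y 0.
  by have := valring_total O (y / x); rewrite invf_div.
have [j _ tj] := extremumP t ord_refl ord_trans ord_total (isT : xpredT i).
exists j => [|k].
  by have := tj i isT; rewrite /ord (negPf ti) => /andP[].
by have /orP[/eqP->|/andP[]//] := tj k isT; rewrite mul0r rpred0.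
Qed.

Lemma sum0_val_unit_ratio (I : finType) (t : I -> L) i :
  \sum_i t i = 0 -> t i != 0 ->
  exists j k, [/\ j != k, t k != 0 & t j / t k \in val_unit O].
Proof.
move=> t0 ti; have [k tk dom] := dominant_term ti.
have [j jk|tm] := pickP (fun j => (j != k) && (t j / t k \notin max_ideal O)).
  by exists j, k; case/andP: jk => jk tjm; rewrite val_unitE dom.
have : \sum_(j | j != k) t j / t k \in max_ideal O.
  by apply: rpred_sum => j jk; have := tm j; rewrite jk => /negPn.
have := congr1 (fun s => s / t k) t0.
rewrite (bigD1 k) //= mulrDl mulr_suml divff // mul0r => /(canRL (addKr _)).
by rewrite addr0 => ->; rewrite rpredN max_ideal1.
Qed.

Lemma max_ideal_horner p x :
  p \is a polyOver (max_ideal O) -> x \in O -> p.[x] \in max_ideal O.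
Proof.
move=> /polyOverP pm xO; rewrite horner_coef rpred_sum // => i _.
by rewrite max_idealMr ?rpredX.
Qed.

End ValuationRingTheory.

(** * Integral elements and the existence of valuation rings *)

Lemma char_poly_polyOver (R : comNzRingType) (O : subringClosed R) n
    (M : 'M[R]_n) :
  (forall i j, M i j \in O) -> char_poly M \is a polyOver O.
Proof.
move=> MO; rewrite /char_poly /determinant rpred_sum // => s _.
rewrite rpredM ?rpredX ?rpredN1 // rpred_prod // => i _.
by rewrite !mxE rpredB ?rpredMn ?polyOverX ?polyOverC.
Qed.

Lemma size_monicB_Xn (R : nzRingType) (p : {poly R}) n :
  p \is monic -> size p = n.+1 -> (size (p - 'X^n)%R <= n)%N.
Proof.
move=> pm sp; apply/leq_sizeP => i; rewrite leq_eqVlt coefB coefXn.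
case/orP => [/eqP<-|ni]; last by rewrite nth_default ?sp // gtn_eqF // subr0.
by have := monicP pm; rewrite lead_coefE sp eqxx => ->; rewrite subrr.
Qed.

Definition integral_elt (L : fieldType) (O : {pred L}) (z : L) : Prop :=
  exists p, [/\ p \is monic, p \is a polyOver O & root p z].

Definition reversal (R : nzRingType) (d : nat) (p : {poly R}) : {poly R} :=
  \poly_(i < d.+1) p`_(d - i).

Lemma reversal_polyOver (R : nzRingType) (O : addrClosed R) d (p : {poly R}) :
  p \is a polyOver O -> reversal d p \is a polyOver O.
Proof. by move=> /polyOverP pO; apply/polyOver_poly. Qed.

Lemma horner_reversal (L : fieldType) d (p : {poly L}) x :
  (size p <= d.+1)%N -> x != 0 -> (reversal d p).[x] = x ^+ d * p.[x^-1].
Proof.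
move=> sp x0; rewrite horner_poly (horner_coef_wide _ sp) mulr_sumr.
rewrite (reindex_inj rev_ord_inj) /=; apply: eq_bigr => i _.
have id : (i <= d)%N by rewrite -ltnS.
have xd : x ^+ d = x ^+ (d - i) * x ^+ i by rewrite -exprD subnK.
by rewrite subSS subKn // mulrCA xd exprVn mulfK ?expf_neq0.
Qed.

Section IntegralElements.
Variables (L : fieldType) (O : subringClosed L).
Implicit Types x z : L.

Lemma integral_elt_mem_of_inv z : integral_elt O z -> z^-1 \in O -> z \in O.
Proof.
move=> [p [pm pO pz]] zVO.
have [->|z0] := eqVneq z 0; first exact: rpred0.
have sp : (1 < size p)%N by rewrite (root_size_gt1 _ pz) ?monic_neq0.
have [d pE] : exists d, size p = d.+2.
  by exists (size p).-2; case: (size p) sp => [|[]].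
pose q := p - 'X^(d.+1); have sq := size_monicB_Xn pm pE.
have -> : z = - (reversal d q).[z^-1].
  rewrite horner_reversal ?invr_eq0 // invrK hornerD hornerN hornerXn (eqP pz).
  by rewrite sub0r mulrN opprK exprVn exprS mulrCA mulVf ?mulr1 // expf_neq0.
rewrite rpredN rpred_horner // reversal_polyOver //.
by rewrite rpredB ?rpredX ?polyOverX.
Qed.

Lemma integral_elt_stable_powers N x z :
  (forall i : 'I_N.+1, exists r,
     [/\ r \is a polyOver O, (size r <= N.+1)%N & z * x ^+ i = r.[x]]) ->
  integral_elt O z.
Proof.
move=> /fin_all_exists[r rP].
pose M : 'M[L]_N.+1 := \matrix_(i, j) (r j)`_i.
exists (char_poly M); split; [exact: char_poly_monic| |].
  by apply: char_poly_polyOver => i j; rewrite mxE; have [/polyOverP] := rP j.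
rewrite -eigenvalue_root_char; apply/eigenvalueP.
exists (\row_i x ^+ i); last first.
  by apply/negP => /eqP /rowP /(_ ord0) /eqP; rewrite !mxE expr0 oner_eq0.
apply/rowP => i; rewrite !mxE; have [_ sr ->] := rP i.
by rewrite (horner_coef_wide _ sr); apply: eq_bigr => j _; rewrite !mxE mulrC.
Qed.

Lemma integral_elt_horner_both p q x z : x != 0 ->
  p \is a polyOver O -> q \is a polyOver O -> z = p.[x] -> z = q.[x^-1] ->
  integral_elt O z.
Proof.
move=> x0 pO qO zp zq.
apply: (@integral_elt_stable_powers (size p + size q) x) => i.
have [iq|qi] := ltnP i (size q).
  exists ('X^i * p); rewrite rpredM ?rpredX ?polyOverX //; split=> //.
    rewrite (leq_trans (size_polyMleq _ _)) // size_polyXn.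
    by rewrite addSn /= addnC ltnW // ltnS leq_add2l ltnW.
  by rewrite hornerM hornerXn zp mulrC.
exists (reversal i q); rewrite reversal_polyOver //; split=> //.
  by rewrite (leq_trans (size_poly _ _)).
by rewrite horner_reversal ?(leq_trans qi) // zq mulrC.
Qed.

Lemma integral_elt_horner_inv p z : z != 0 ->
  p \is a polyOver O -> z = p.[z^-1] -> integral_elt O z.
Proof.
by move=> z0 pO zp; apply: (@integral_elt_horner_both 'X p z);
  rewrite ?polyOverX ?hornerX.
Qed.

End IntegralElements.

Lemma valring_integral_elt (L : fieldType) (O : valuationRing L) z :
  integral_elt O z -> z \in O.
Proof.
move=> zint.
by have /orP[|/(integral_elt_mem_of_inv zint)] := valring_total O z.
Qed.

Lemma Zorn_bigcup_nonempty (T : Type) (P : set (set T)) (A0 : set T) : P A0 ->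
  (forall F : set (set T), F !=set0 -> F `<=` P -> total_on F subset ->
     P (\bigcup_(X in F) X)) ->
  exists2 A, P A & forall B, A `<` B -> ~ P B.
Proof.
move=> PA0 Pcup.
have [F FP Ftot|A [PA Amax]] := @Zorn_bigcup T [set A | P A \/ A = set0].
  have [[X [FX PX]]|noX] := pselect (exists X, F X /\ P X); last first.
    right; rewrite -subset0 => x [X FX Xx]; case: (FP X FX) => [PX|X0].
      by apply: noX; exists X.
    by rewrite X0 in Xx.
  left; have -> : \bigcup_(X in F) X = \bigcup_(X in F `&` P) X.
    apply/seteqP; split=> x [Y] => [FY Yx|[FY _] Yx]; exists Y => //.
    by split=> //; case: (FP Y FY) => // Y0; rewrite Y0 in Yx.
  by apply: Pcup => [|Y []//|Y Z [FY _] [FZ _]]; [exists X|exact: Ftot].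
case: PA => [PA|A_0]; first by exists A => // B /Amax nB PB; apply: nB; left.
have A00 : A0 = set0.
  rewrite -subset0 => x A0x; apply: (Amax A0); last by left.
  by rewrite A_0; split=> // A0A; exact: A0A A0x.
by exists A; [rewrite A_0 -A00|move=> B /Amax nB PB; apply: nB; left].
Qed.

Lemma bigcup_chain_closed2 (T : Type) (F : set (set T)) (op : T -> T -> T) x y :
  total_on F subset ->
  (forall X, F X -> forall u v, X u -> X v -> X (op u v)) ->
  (\bigcup_(X in F) X) x -> (\bigcup_(X in F) X) y ->
  (\bigcup_(X in F) X) (op x y).
Proof.
move=> Ftot Fop [X FX Xx] [Y FY Yy].
have [XY|YX] := Ftot X Y FX FY.
  by exists Y => //; apply: Fop => //; exact: XY.
by exists X => //; apply: Fop => //; exact: YX.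
Qed.

Section ValuationRingExistence.
Variables (L : fieldType) (R : subringClosed L).
Implicit Types x z : L.

Definition adjoin (O : {pred L}) x : set L :=
  [set y | exists2 p, p \is a polyOver O & y = p.[x]].

Lemma adjoin_subring_closed (O : subringClosed L) x :
  subring_closed [in adjoin O x].
Proof.
split=> [|u v|u v]; rewrite ?in_setE.
- by exists 1; rewrite ?rpred1 ?hornerC.
- move=> [p pO ->] [q qO ->].
  by exists (p - q); rewrite ?rpredB ?hornerD ?hornerN.
- by move=> [p pO ->] [q qO ->]; exists (p * q); rewrite ?rpredM ?hornerM.
Qed.

Lemma adjoin_base (O : addrClosed L) x : [set` O] `<=` adjoin O x.
Proof. by move=> y yO; exists y%:P; rewrite ?polyOverC ?hornerC. Qed.

Lemma adjoin_gen (O : subringClosed L) x : adjoin O x x.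
Proof. by exists 'X; rewrite ?polyOverX ?hornerX. Qed.

Definition subring_avoiding z (A : set L) : Prop :=
  [/\ subring_closed [in A], [set` R] `<=` A, A z^-1 & ~ A z].

Lemma subring_avoiding_bigcup z (F : set (set L)) :
  F !=set0 -> F `<=` subring_avoiding z -> total_on F subset ->
  subring_avoiding z (\bigcup_(X in F) X).
Proof.
move=> [X0 FX0] FP Ftot; have [[A1 _ _] RA zVA _] := FP _ FX0.
split.
- split=> [|x y|x y]; rewrite ?in_setE; first by exists X0; rewrite // -in_setE.
    apply: (bigcup_chain_closed2 (op := fun u v => u - v) Ftot) => X FX u v.
    by have [[_ + _] _ _ _] := FP X FX => /(_ u v); rewrite !in_setE.
  apply: (bigcup_chain_closed2 (op := *%R) Ftot) => X FX u v.
  by have [[_ _ +] _ _ _] := FP X FX => /(_ u v); rewrite !in_setE.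
- by move=> x /RA; exists X0.
- by exists X0.
- by move=> [X FX Xz]; have [_ _ _] := FP X FX.
Qed.

(* Let O be maximal among the rings containing R and z^-1 but not z. If neither x
   nor x^-1 lies in O, then z is a polynomial in x and a polynomial in x^-1 over
   O, hence integral over O, hence in O. *)
Lemma exists_valuation_ring z : ~ integral_elt R z ->
  exists O : valuationRing L, {subset R <= O} /\ z \notin O.
Proof.
move=> zint; have z0 : z != 0.
  apply: contra_not_neq zint => ->.
  by exists 'X; rewrite monicX polyOverX rootX eqxx.
have [|A [Asub RA zVA zA] Amax] :=
    Zorn_bigcup_nonempty (A0 := adjoin R z^-1) _ (@subring_avoiding_bigcup z).
  split; [exact: adjoin_subring_closed|exact: adjoin_base|exact: adjoin_gen|].
  by move=> [p pR zp]; exact/zint/(integral_elt_horner_inv z0 pR zp).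
pose O := [in A]; pose OB := GRing.isSubringClosed.Build L O Asub.
pose Osub : subringClosed L := HB.pack O OB.
have OE x : (x \in Osub) = (x \in A) by [].
have adj x : x \notin A -> adjoin Osub x z.
  move=> /negP xA; apply: contrapT => nz; apply: (Amax (adjoin Osub x)).
    split=> [y|AC]; first by rewrite -in_setE -OE => /adjoin_base; exact.
    by apply: xA; rewrite in_setE; exact/AC/adjoin_gen.
  have Osubx := @adjoin_base Osub x.
  split=> //; first exact: adjoin_subring_closed.
    by move=> y /RA yA; apply: Osubx; rewrite /= OE in_setE.
  by apply: Osubx; rewrite /= OE in_setE.
have Ototal x : (x \in O) || (x^-1 \in O).
  apply/negP => /negP; rewrite negb_or => /andP[xO xVO].
  have x0 : x != 0 by apply: contraNneq xO => ->; exact: (rpred0 Osub).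
  have [[p pO zp] [q qO zq]] := (adj _ xO, adj _ xVO).
  apply: zA; rewrite -in_setE -OE.
  apply: integral_elt_mem_of_inv (integral_elt_horner_both x0 pO qO zp zq) _.
  by rewrite OE in_setE.
pose Oval : valuationRing L := HB.pack O OB (isValuationRing.Build L O Ototal).
exists Oval; split.
  by move=> x /RA; rewrite -in_setE.
by apply/negP; rewrite [_ \in _]OE in_setE.
Qed.

End ValuationRingExistence.

(** * Discrete valuation rings *)

Definition uniformizer (K : fieldType) (V : {pred K}) (pi : K) : Prop :=
  [/\ pi != 0, pi \in max_ideal V
    & forall x, x != 0 -> exists l : int, x / pi ^ l \in val_unit V].

Definition residue_system (K : fieldType) (V : {pred K})
    (T : finType) (rep : T -> K) : Prop :=
  (forall t, rep t \in V) /\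
  (forall x, x \in V -> exists t, x - rep t \in max_ideal V).

Lemma exists_common_bound (I : finType) (P : I -> nat -> Prop) :
  (forall i k l, (k <= l)%N -> P i k -> P i l) -> (forall i, exists k, P i k) ->
  exists k, forall i, P i k.
Proof.
move=> Pmono /fin_all_exists[k kP]; exists (\max_i k i)%N => i.
exact/Pmono/kP/leq_bigmax.
Qed.

Section Uniformizer.
Variables (K : fieldType) (V : valuationRing K) (pi : K).
Hypothesis Vpi : uniformizer V pi.

Lemma uniformizer_mem : pi \in V.
Proof. by case: Vpi => _ /max_ideal_sub. Qed.

Lemma max_ideal_uniformizer x : (x \in max_ideal V) = (x / pi \in V).
Proof.
have [pi0 pim dec] := Vpi; have piV := uniformizer_mem.
have [->|x0] := eqVneq x 0; first by rewrite mul0r !rpred0.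
apply/idP/idP => [xm|xpiV]; last by rewrite -(divfK pi0 x) max_idealMl.
have [l] := dec x x0.
have : x = x / pi ^ l * pi ^ l by rewrite divfK ?expfz_neq0.
move: (x / pi ^ l) => u xE /val_unitP[u0 uV uVV].
case: l xE => [[|l]|l] xE.
- by have := xm; rewrite xE expr0z mulr1 max_idealE (negPf u0) uVV.
- by rewrite xE -exprnP exprSr mulrA mulfK // rpredM ?rpredX.
- have := xm; rewrite max_idealE (negPf x0) /= => /negP[].
  by rewrite xE NegzE -exprnN invfM invrK rpredM ?rpredX.
Qed.

Lemma uniformizer_clear_denominators (I : finType) (F : I -> {poly K}) :
  exists k : nat, forall i, pi ^+ k *: F i \is a polyOver V.
Proof.
have [pi0 _ dec] := Vpi; have piV := uniformizer_mem.
have clear_mono (c : K) k l :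
    (k <= l)%N -> pi ^+ k * c \in V -> pi ^+ l * c \in V.
  by move=> /subnK <-; rewrite exprD -mulrA => cV; rewrite rpredM ?rpredX.
have clear_elt (c : K) : exists k, pi ^+ k * c \in V.
  have [->|c0] := eqVneq c 0; first by exists 0%N; rewrite mulr0 rpred0.
  have [l /val_unit_sub lV] := dec c c0.
  have cE : c = c / pi ^ l * pi ^ l by rewrite divfK ?expfz_neq0.
  exists `|l|%N; rewrite cE mulrCA rpredM //.
  case: l {lV cE} => l; first by rewrite absz_nat -exprnP -exprD rpredX.
  by rewrite NegzE -exprnN abszN /= mulfV ?rpred1 // expf_neq0.
apply: exists_common_bound => [i k l kl /polyOverP FV|i].
  by apply/polyOverP => j; have := FV j; rewrite !coefZ; exact: clear_mono.
have [|k kV] := exists_common_bound (P := fun (j : 'I_(size (F i))) k =>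
    pi ^+ k * (F i)`_j \in V) _ (fun j => clear_elt _).
  by move=> j; exact: clear_mono.
exists k; apply/polyOverP => j; rewrite coefZ.
have [jF|Fj] := ltnP j (size (F i)); first exact: (kV (Ordinal jF)).
by rewrite nth_default // mulr0 rpred0.
Qed.

End Uniformizer.

Lemma polyOver_MXaddC (R : nzRingType) (S : subringClosed R) (p : {poly R}) c :
  p * 'X + c%:P \is a polyOver S -> p \is a polyOver S /\ c \in S.
Proof.
move=> /polyOverP pcS; split.
  by apply/polyOverP => i; have := pcS i.+1; rewrite coefD coefMX coefC addr0.
by have := pcS 0%N; rewrite coefD coefMX coefC add0r.
Qed.

Lemma poly_sum_wide (R : nzRingType) (p : {poly R}) n :
  (size p <= n)%N -> p = \sum_(i < n) p`_i *: 'X^i.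
Proof.
move=> sp; rewrite -poly_def; apply/polyP => i; rewrite coef_poly.
by case: ltnP => // ni; rewrite nth_default // (leq_trans sp).
Qed.

Lemma divp_modp_monic_polyOver (K : fieldType) (V : subringClosed K)
    (d p : {poly K}) :
  d \is monic -> d \is a polyOver V -> p \is a polyOver V ->
  p %/ d \is a polyOver V /\ p %% d \is a polyOver V.
Proof.
move=> dm dV; elim/poly_ind: p => [|p c IH pcV].
  by rewrite div0p mod0p !rpred0.
have [/IH[qV rV] cV] := polyOver_MXaddC pcV.
pose r := (p %% d) * 'X + c%:P; pose a := r`_(size d).-1.
have sd : (size d).-1.+1 = size d by rewrite prednK ?size_poly_gt0 ?monic_neq0.
have {}rV : r \is a polyOver V.
  by rewrite rpredD ?polyOverC // rpredM ?polyOverX.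
have aV : a \in V := polyOverP rV _.
have sr : (size r <= size d)%N.
  rewrite /r size_MXaddC; case: ifP => // _.
  by rewrite ltn_modp monic_neq0.
have pE : p * 'X + c%:P = (p %/ d * 'X + a%:P) * d + (r - a *: d).
  by rewrite {1}(divp_eq p d) /r -mul_polyC; ring.
have sra : (size (r - a *: d)%R < size d)%N.
  rewrite -sd ltnS; apply/leq_sizeP => j; rewrite leq_eqVlt coefB coefZ.
  case/orP => [/eqP<-|]; first by rewrite -lead_coefE (monicP dm) mulr1 subrr.
  rewrite sd => dj; have rj : (size r <= j)%N := leq_trans sr dj.
  by rewrite [r`_j]nth_default // [d`_j]nth_default // mulr0 subr0.
have [<- <-] := (divpP pE sra, modpP pE sra).
by rewrite rpredD ?rpredB ?polyOverC ?polyOverZ // rpredM ?polyOverX.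
Qed.

Section ResiduePolynomials.
Variables (K : fieldType) (V : valuationRing K) (T : finType) (rep : T -> K).
Hypothesis Vrep : residue_system V rep.
Variable n : nat.

Definition residue_poly (c : {ffun 'I_n -> T}) : {poly K} :=
  \sum_(i < n) rep (c i) *: 'X^i.

Lemma size_residue_poly c : (size (residue_poly c) <= n)%N.
Proof.
apply: (leq_trans (size_sum _ _ _)); apply/bigmax_leqP => i _.
by rewrite (leq_trans (size_scale_leq _ _)) // size_polyXn.
Qed.

Lemma residue_poly_polyOver c : residue_poly c \is a polyOver V.
Proof.
by apply: rpred_sum => i _; rewrite polyOverZ ?rpredX ?polyOverX //; case: Vrep.
Qed.

Lemma residue_poly_approx p : p \is a polyOver V -> (size p <= n)%N ->
  exists c, p - residue_poly c \is a polyOver (max_ideal V).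
Proof.
move=> /polyOverP pV sp.
have /fin_all_exists[c cP] (i : 'I_n) : exists t, p`_i - rep t \in max_ideal V.
  by case: Vrep => _; apply.
exists [ffun i => c i]; rewrite {1}(poly_sum_wide sp).
rewrite /residue_poly -sumrB rpred_sum // => i _; apply/polyOverP => j.
rewrite ffunE -scalerBl coefZ coefXn max_idealMr //.
by case: (_ == _); rewrite ?rpred1 ?rpred0.
Qed.

End ResiduePolynomials.

(** * Prolongations to extensions of bounded degree *)

Definition prolongs (K L : fieldType) (V : {pred K}) (kappa : K -> L)
    (O : {pred L}) : Prop :=
  forall c, (kappa c \in O) = (c \in V).

Definition algebraic_deg_le (K L : fieldType) (n : nat) (kappa : K -> L)
    (y : L) : Prop :=
  exists p : {poly K},
    [/\ p != 0, (size p <= n.+1)%N & root (map_poly kappa p) y].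

Section AlgebraicElements.
Variables (K L : fieldType) (n : nat) (kappa : {rmorphism K -> L}) (y : L).
Hypothesis yn : algebraic_deg_le n kappa y.
Local Notation ev p := (map_poly kappa p).[y].

(* The n + 1 polynomials u^i v^(n - i) are linearly dependent modulo a
   polynomial of degree at most n that vanishes at y. *)
Lemma algebraic_deg_le_ratio u v :
  ev v != 0 -> algebraic_deg_le n kappa (ev u / ev v).
Proof.
move=> v0; have [h [h0 sh /eqP hy0]] := yn.
pose P (i : 'I_n.+1) := (u ^+ i * v ^+ (n - i)) %% h.
have evP i : ev (P i) = ev u ^+ i * ev v ^+ (n - i).
  have := congr1 (fun p => ev p) (divp_eq (u ^+ i * v ^+ (n - i)) h).
  rewrite /= !(rmorphM, rmorphD) !(hornerM, hornerD) /= hy0 mulr0 add0r => <-.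
  by rewrite !rmorphXn !horner_exp.
have sP i : (size (P i) <= n)%N by rewrite -ltnS (leq_trans _ sh) // ltn_modp.
pose M : 'M[K]_(n.+1, n) := \matrix_i poly_rV (P i).
have [c cM c0] : exists2 c : 'rV_n.+1, c *m M = 0 & c != 0.
  apply: contrapT => noc; have : row_free M.
    apply: inj_row_free => c cM; apply/eqP/negPn/negP => c0.
    by apply: noc; exists c.
  by rewrite /row_free => /eqP rM; have := rank_leq_col M; rewrite rM ltnn.
have cP : \sum_i c 0 i *: P i = 0.
  have := congr1 rVpoly cM; rewrite mulmx_sum_row linear_sum linear0 => cM0.
  rewrite -[RHS]cM0; apply: eq_bigr => i _.
  by rewrite linearZ rowK /= poly_rV_K.
exists (rVpoly c); split; last 2 first.
- by rewrite size_poly.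
- rewrite /root (@horner_coef_wide _ n.+1) ?size_map_poly ?size_poly //.
  have : ev (\sum_i c 0 i *: P i) / ev v ^+ n = 0.
    by rewrite cP rmorph0 horner0 mul0r.
  rewrite rmorph_sum horner_sum mulr_suml => ev0; rewrite -[X in _ == X]ev0.
  apply/eqP/eq_bigr => i _; have id : (i <= n)%N by rewrite -ltnS.
  have vn : ev v ^+ n = ev v ^+ (n - i) * ev v ^+ i by rewrite -exprD subnK.
  rewrite coef_map coef_rVpoly_ord /= map_polyZ hornerZ evP vn expr_div_n.
  by field; rewrite !expf_neq0.
- by apply: contraNneq c0 => c0; rewrite -[c]rVpolyK c0 linear0.
Qed.

Lemma algebraic_deg_le_horner u : algebraic_deg_le n kappa (ev u).
Proof.
have := @algebraic_deg_le_ratio u 1; rewrite rmorph1 hornerC divr1; apply.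
exact: oner_neq0.
Qed.

End AlgebraicElements.

Lemma exists_power_one_unit (L : fieldType) (O : valuationRing L) (T : finType)
    (rep : T -> L) y :
  y \in val_unit O -> (forall k, exists t, y ^+ k - rep t \in max_ideal O) ->
  exists e, [/\ (0 < e)%N, (e <= #|T|)%N & y ^+ e \in one_unit O].
Proof.
move=> yu yrep; have /fin_all_exists[F yF] (k : 'I_#|T|.+1) := yrep k.
have /injectivePn[k1 [k2 k12 F12]] : ~~ injectiveb F.
  by apply/injectiveP => /leq_card; rewrite card_ord ltnn.
have ym : y ^+ k1 - y ^+ k2 \in max_ideal O.
  by have := rpredB (yF k1) (yF k2); rewrite F12 opprB addrA subrK.
have /val_unitP[y0 yO yVO] := yu.
have ratio_unit (i j : nat) : (i <= j)%N -> y ^+ i - y ^+ j \in max_ideal O ->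
    y ^+ (j - i) \in one_unit O.
  move=> ij ijm; rewrite one_unitE expfB_cond ?(negPf y0) //.
  have -> : y ^+ j / y ^+ i - 1 = - (y ^+ i - y ^+ j) * y^-1 ^+ i.
    by rewrite exprVn opprB mulrBl divff ?expf_neq0.
  by rewrite max_idealMr ?rpredN ?rpredX.
have dist_le (i j : 'I_#|T|.+1) : (j - i <= #|T|)%N.
  by rewrite (leq_trans (leq_subr _ _)) // -ltnS.
case: (ltngtP k1 k2) k12 => [lt12|lt21|/val_inj->]; last by rewrite eqxx.
- by exists (k2 - k1)%N; rewrite subn_gt0 lt12 dist_le ratio_unit // ltnW.
- exists (k1 - k2)%N; rewrite subn_gt0 lt21 dist_le ratio_unit // 1?ltnW //.
  by rewrite -rpredN opprB.
Qed.

Section Prolongation.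
Variables (K : fieldType) (V : valuationRing K).
Variables (L : fieldType) (kappa : {rmorphism K -> L}) (O : valuationRing L).
Hypothesis VO : prolongs V kappa O.

Lemma prolongs_max_ideal c : (kappa c \in max_ideal O) = (c \in max_ideal V).
Proof. by rewrite !max_idealE fmorph_eq0 -fmorphV VO. Qed.

Lemma prolongs_val_unit c : (kappa c \in val_unit O) = (c \in val_unit V).
Proof. by rewrite !val_unitE prolongs_max_ideal VO. Qed.

Lemma prolongs_polyOver p :
  p \is a polyOver V -> map_poly kappa p \is a polyOver O.
Proof. by move=> /polyOverP pV; apply/polyOverP => i; rewrite coef_map VO. Qed.

Lemma prolongs_polyOver_max_ideal p :
  p \is a polyOver (max_ideal V) ->
  map_poly kappa p \is a polyOver (max_ideal O).
Proof.
move=> /polyOverP pV; apply/polyOverP => i.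
by rewrite coef_map prolongs_max_ideal.
Qed.

Variables (n : nat) (y : L).
Hypothesis yn : algebraic_deg_le n kappa y.

Lemma primitive_annihilator : exists q : {poly K},
  [/\ q \is a polyOver V, (size q <= n.+1)%N, root (map_poly kappa q) y
    & exists i, q`_i \notin max_ideal V].
Proof.
have [p [p0 sp py]] := yn.
have lead_lt : ((size p).-1 < n.+1)%N by rewrite prednK ?size_poly_gt0.
pose t (i : 'I_n.+1) := p`_i.
have [|j pj dom] := dominant_term V (t := t) (i := Ordinal lead_lt).
  by rewrite /t /= -lead_coefE lead_coef_eq0.
exists ((p`_j)^-1 *: p); split.
- apply/polyOverP => i; rewrite coefZ mulrC.
  have [ip|pi] := ltnP i n.+1; first exact: (dom (Ordinal ip)).
  by rewrite [p`_i]nth_default ?mul0r ?rpred0 // (leq_trans sp).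
- by rewrite (leq_trans (size_scale_leq _ _)).
- by rewrite map_polyZ rootZ // fmorph_eq0 invr_eq0.
by exists j; rewrite coefZ mulVf // max_ideal1.
Qed.

(* A primitive annihilator of y becomes monic modulo the maximal ideal, up to a
   unit, once the coefficients that vanish there are dropped. *)
Lemma monic_residue_annihilator : y \in O -> exists psi : {poly K},
  [/\ psi \is monic, psi \is a polyOver V, (size psi <= n.+1)%N
    & (map_poly kappa psi).[y] \in max_ideal O].
Proof.
move=> yO; have [q [/polyOverP qV sq /eqP qy qprim]] := primitive_annihilator.
have qsz i : q`_i \notin max_ideal V -> (i <= n)%N.
  apply: contraR; rewrite -ltnNge => ni.
  by rewrite nth_default ?rpred0 // (leq_trans sq).
have [d qd dmax] := ex_maxnP qprim qsz.
have qdu : q`_d \in val_unit V by rewrite val_unitE qV.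
pose r := take_poly d.+1 q; exists ((q`_d)^-1 *: r).
have sr : size r = d.+1.
  apply/eqP; rewrite eqn_leq size_take_poly ltnNge; apply/negP => /leq_sizeP.
  move=> /(_ d (leqnn d)); rewrite coef_take_poly ltnSn => /eqP.
  by rewrite (negPf (val_unit_neq0 qdu)).
have spsi : size ((q`_d)^-1 *: r) = d.+1.
  by rewrite size_scale // invr_eq0 (val_unit_neq0 qdu).
have tailV : q - r \is a polyOver (max_ideal V).
  apply/polyOverP => i; rewrite coefB coef_take_poly; case: ltnP => di.
    by rewrite subrr rpred0.
  by rewrite subr0; apply/negPn/negP => /dmax; rewrite leqNgt di.
have tail_y : (map_poly kappa (q - r)).[y] = - (map_poly kappa r).[y].
  by rewrite rmorphB hornerD hornerN /= qy sub0r.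
split.
- rewrite monicE lead_coefE spsi coefZ coef_take_poly ltnSn mulVf //.
  exact: val_unit_neq0 qdu.
- apply/polyOverP => i; rewrite coefZ coef_take_poly rpredM //.
    by case/val_unitP: qdu.
  by case: ifP; rewrite ?rpred0.
- by rewrite spsi ltnS qsz.
rewrite map_polyZ hornerZ max_idealMl //.
  by rewrite VO; case/val_unitP: qdu.
rewrite -rpredN -tail_y max_ideal_horner //.
exact: prolongs_polyOver_max_ideal.
Qed.

Lemma val_unit_residue_power (T : finType) (rep : T -> K) :
  residue_system V rep -> y \in val_unit O -> y ^+ (#|T| ^ n)`! \in one_unit O.
Proof.
move=> Vrep yu; have yO := val_unit_sub yu.
have [psi [psim psiV spsi psiy]] := monic_residue_annihilator yO.
have [|e [e_gt0 ele yeu]] := exists_power_one_unit (T := {ffun 'I_n -> T})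
    (rep := fun c => (map_poly kappa (residue_poly rep c)).[y]) yu.
  move=> k; have XkV := rpredX k (polyOverX V).
  have [XqV XrV] := divp_modp_monic_polyOver psim psiV XkV.
  have [|c cm] := residue_poly_approx Vrep XrV (n := n).
    by rewrite -ltnS (leq_trans _ spsi) // ltn_modp monic_neq0.
  exists c; have -> : y ^+ k - (map_poly kappa (residue_poly rep c)).[y] =
      (map_poly kappa ('X^k %/ psi)).[y] * (map_poly kappa psi).[y] +
      (map_poly kappa ('X^k %% psi - residue_poly rep c)).[y].
    rewrite -hornerM -rmorphM -hornerD -rmorphD addrA -divp_eq rmorphB.
    by rewrite hornerD hornerN /= map_polyXn hornerXn.
  apply: rpredD; last by rewrite max_ideal_horner ?prolongs_polyOver_max_ideal.
  by rewrite max_idealMl // rpred_horner ?prolongs_polyOver.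
have /dvdnP[a ->] : (e %| (#|T| ^ n)`!)%N.
  by rewrite dvdn_fact // e_gt0; move: ele; rewrite card_ffun card_ord.
by rewrite mulnC exprM rpredX.
Qed.

Variable pi : K.
Hypothesis Vpi : uniformizer V pi.

Lemma prolongs_uniformizer_neq0 : kappa pi != 0.
Proof. by rewrite fmorph_eq0; case: Vpi. Qed.

Lemma prolongs_uniformizer_max_ideal : kappa pi \in max_ideal O.
Proof. by rewrite prolongs_max_ideal; case: Vpi. Qed.

Lemma ramification_power :
  y != 0 -> exists l : int, y ^+ n`! / kappa pi ^ l \in val_unit O.
Proof.
move=> y0; have [p [p0 sp /eqP py]] := yn.
pose t (i : 'I_n.+1) := kappa p`_i * y ^+ i.
have lead_lt : ((size p).-1 < n.+1)%N by rewrite prednK ?size_poly_gt0.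
have [||j [k [jk tk0 tjku]]] :=
    sum0_val_unit_ratio O (t := t) (i := Ordinal lead_lt).
- apply: etrans py; rewrite (@horner_coef_wide _ n.+1) ?size_map_poly //.
  by apply: eq_bigr => i _; rewrite coef_map.
- by rewrite mulf_neq0 ?expf_neq0 // fmorph_eq0 -lead_coefE lead_coef_eq0.
have tj0 : t j != 0.
  by apply: contraTneq (val_unit_neq0 tjku) => ->; rewrite mul0r eqxx.
have [pj0 pk0] : p`_j != 0 /\ p`_k != 0.
  move: tj0 tk0; rewrite !mulf_eq0 !negb_or !fmorph_eq0.
  by move=> /andP[-> _] /andP[->].
have [_ _ dec] := Vpi; have [|l] := dec (p`_j / p`_k).
  by rewrite mulf_neq0 ?invr_eq0.
rewrite -prolongs_val_unit => lu; have w0 := prolongs_uniformizer_neq0.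
have yd_unit : y ^ (j%:Z - k%:Z) * kappa pi ^ l \in val_unit O.
  have -> : y ^ (j%:Z - k%:Z) * kappa pi ^ l =
      (t j / t k) / kappa (p`_j / p`_k / pi ^ l).
    rewrite expfzDr // -invr_expz -!exprnP /t !(rmorphM, fmorphV) /= fmorphXz.
    by field; rewrite expfz_neq0 // expf_neq0 // !fmorph_eq0 pj0 pk0.
  by apply: rpredM; rewrite ?rpredV.
have /dvdzP[e nE] : ((j%:Z - k%:Z)%R %| (n`!)%:Z)%Z.
  rewrite dvdzE dvdn_fact // absz_gt0 subr_eq0 eqz_nat.
  have := ltn_ord j; have := ltn_ord k; move: jk; rewrite -(inj_eq val_inj) /=.
  move: (nat_of_ord j) (nat_of_ord k) => a b; lia.
exists (- (l * e)); rewrite invr_expz opprK exprnP nE mulrC [e * _]mulrC.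
by rewrite -!exprz_exp mulrC -expfzMl rpredXz.
Qed.

End Prolongation.

Definition expansion_exponent (n q : nat) : nat := n`! * (q ^ n)`!.

Lemma expansion_exponent_gt0 n q : (0 < expansion_exponent n q)%N.
Proof. by rewrite muln_gt0 !fact_gt0. Qed.

Section UniformizerPowers.
Variables (L : fieldType) (O : valuationRing L) (w : L).
Hypotheses (w0 : w != 0) (wm : w \in max_ideal O).

Lemma exprz_valring (l : int) : (w ^ l \in O) = (0 <= l).
Proof.
have wX k : w ^+ k \in O by rewrite rpredX ?max_ideal_sub.
case: l => l; first by rewrite -exprnP wX.
have := max_idealX wm (ltn0Sn l).
rewrite max_idealE expf_eq0 (negPf w0) andbF /=.
by rewrite NegzE -exprnN => /negPf.
Qed.

Lemma exprz_max_ideal (l : int) : (w ^ l \in max_ideal O) = (0 < l).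
Proof.
rewrite max_idealE (negPf (expfz_neq0 l w0)) /= invr_expz exprz_valring.
by rewrite oppr_ge0 ltNge.
Qed.

End UniformizerPowers.

Section Expansion.
Variables (K : fieldType) (V : valuationRing K) (pi : K).
Variables (T : finType) (rep : T -> K).
Hypotheses (Vpi : uniformizer V pi) (Vrep : residue_system V rep).
Variables (L : fieldType) (kappa : {rmorphism K -> L}) (O : valuationRing L).
Hypothesis VO : prolongs V kappa O.
Variables (n : nat) (y : L).
Hypothesis yn : algebraic_deg_le n kappa y.

Local Notation N := (expansion_exponent n #|T|).
Local Notation w := (kappa pi).
Let w0 : w != 0 := prolongs_uniformizer_neq0 kappa Vpi.
Let wm : w \in max_ideal O := prolongs_uniformizer_max_ideal VO Vpi.

Lemma val_unit_expansion : y \in val_unit O -> y ^+ N \in one_unit O.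
Proof.
move=> yu; rewrite /expansion_exponent mulnC exprM rpredX //.
exact: (val_unit_residue_power VO yn Vrep).
Qed.

Hypothesis y0 : y != 0.

Lemma one_unit_expansion : exists l : int, y ^+ N / w ^ l \in one_unit O.
Proof.
have [l lu] := ramification_power VO yn Vpi y0.
exists (l * (#|T| ^ n)`!%:Z); rewrite -exprz_exp -exprnP /expansion_exponent.
rewrite exprM -expr_div_n.
have yl : algebraic_deg_le n kappa (y ^+ n`! / w ^ l).
  have := algebraic_deg_le_horner yn (pi ^ (- l) *: 'X^(n`!)).
  by rewrite map_polyZ hornerZ map_polyXn hornerXn /= fmorphXz mulrC -invr_expz.
exact: (val_unit_residue_power VO yl Vrep lu).
Qed.

Lemma max_ideal_expansion : y \in max_ideal O -> y ^+ N / w \in O.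
Proof.
move=> ym; have [l lu] := one_unit_expansion.
have yE : y ^+ N = y ^+ N / w ^ l * w ^ l by rewrite divfK ?expfz_neq0.
have l_gt0 : 0 < l.
  rewrite -(exprz_max_ideal w0 wm).
  have := max_idealX ym (expansion_exponent_gt0 n #|T|).
  rewrite yE => /(max_idealMl (val_unit_sub (rpredVr (one_unit_val_unit lu)))).
  by rewrite mulKf // mulf_neq0 ?invr_eq0 ?expfz_neq0 ?expf_neq0.
rewrite yE -mulrA -[w^-1]exprN1 -expfzDr // rpredM ?(one_unit_sub lu) //.
by rewrite (exprz_valring w0 wm) subr_ge0.
Qed.

Lemma one_unit_expansion_bound k : y \in O -> w ^+ k / y \in O ->
  exists2 l : nat, (l <= k * N)%N & y ^+ N / w ^+ l \in one_unit O.
Proof.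
move=> yO kO; have [l lu] := one_unit_expansion.
have [yN0 wl0] := (expf_neq0 N y0, expfz_neq0 l w0).
have /val_unitP[_ uO uVO] := one_unit_val_unit lu.
have l_ge0 : 0 <= l.
  rewrite -(exprz_valring w0 wm); have : (y ^+ N / w ^ l)^-1 * y ^+ N \in O.
    by rewrite rpredM // rpredX.
  by rewrite invf_div divfK.
have l_le : l <= (k * N)%:Z.
  rewrite -subr_ge0 -(exprz_valring w0 wm).
  have -> : w ^ ((k * N)%:Z - l) = (w ^+ k / y) ^+ N * (y ^+ N / w ^ l).
    by rewrite expfzDr // -invr_expz -exprnP expr_div_n -exprM mulrA divfK.
  by rewrite rpredM // rpredX.
by case: l l_ge0 l_le lu {wl0 uO uVO} => // l _; exists l.
Qed.

End Expansion.

(** * Forms that compute maxima *)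

Section MaxForm.
Variables (I : eqType) (N : nat).
Implicit Types (R : comNzRingType) (s : seq I).

Definition max_form_degree s : nat := N * 2 ^ size s.

(* If a and b are 0 or 1, then a^2 - a b + b^2 = max(a, b). *)
Fixpoint max_form R (g : I -> R) s : R :=
  if s is i :: s' then
    let a := max_form g s' in let b := g i ^+ max_form_degree s' in
    a ^+ 2 - a * b + b ^+ 2
  else 0.

Fixpoint max_form_cofactor R (g : I -> R) s (j : I) : R :=
  if s is i :: s' then
    max_form g s' * max_form_cofactor g s' j +
    (if j == i then g i ^+ (max_form_degree s).-1
       - max_form g s' * g i ^+ (max_form_degree s').-1 else 0)
  else 0.

Lemma max_form_degree_cons i s :
  max_form_degree (i :: s) = (max_form_degree s + max_form_degree s)%N.
Proof. by rewrite addnn -muln2 -mulnA -expnSr. Qed.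

Lemma rmorph_max_form R R' (f : {rmorphism R -> R'}) (g : I -> R) s :
  f (max_form g s) = max_form (f \o g) s.
Proof.
elim: s => [|i s IH]; first exact: rmorph0.
by rewrite /= !(rmorphD, rmorphN, rmorphM, rmorphXn) /= IH.
Qed.

Lemma rmorph_max_form_cofactor R R' (f : {rmorphism R -> R'}) (g : I -> R) s j :
  f (max_form_cofactor g s j) = max_form_cofactor (f \o g) s j.
Proof.
elim: s => [|i s IH]; first exact: rmorph0.
rewrite /= rmorphD rmorphM rmorph_max_form IH; congr (_ + _).
case: (_ == _); last exact: rmorph0.
by rewrite !(rmorphB, rmorphM, rmorphXn) rmorph_max_form.
Qed.

Lemma max_formM R m (g : I -> R) s :
  max_form (fun i => m * g i) s = m ^+ max_form_degree s * max_form g s.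
Proof.
elim: s => [|i s IH]; first by rewrite /= mulr0.
rewrite /= IH max_form_degree_cons exprD !exprMn.
by move: (m ^+ _) (max_form g s) (g i ^+ _) => u a b; ring.
Qed.

Hypothesis N_gt0 : (0 < N)%N.

Lemma max_form_degree_gt0 s : (0 < max_form_degree s)%N.
Proof. by rewrite muln_gt0 N_gt0 expn_gt0. Qed.

Lemma max_form_degree_cons_pred i s :
  (max_form_degree (i :: s)).-1 =
    (max_form_degree s + (max_form_degree s).-1)%N.
Proof.
by rewrite max_form_degree_cons -{2}(prednK (max_form_degree_gt0 s)) addnS.
Qed.

Lemma max_form_cofactorM R m (g : I -> R) s j :
  max_form_cofactor (fun i => m * g i) s j =
  m ^+ (max_form_degree s).-1 * max_form_cofactor g s j.
Proof.
elim: s => [|i s IH]; first by rewrite /= mulr0.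
rewrite /= IH max_formM max_form_degree_cons_pred mulrDr !exprD; congr (_ + _).
  by rewrite mulrACA.
case: (_ == _); last by rewrite mulr0.
rewrite !exprMn; move: (m ^+ _) (m ^+ _) (g i ^+ _) (g i ^+ _) => u v x y.
by ring.
Qed.

End MaxForm.

Lemma max_form_sum (I : finType) (N : nat) (R : comNzRingType) (g : I -> R) s :
  (0 < N)%N -> \sum_j g j * max_form_cofactor N g s j = max_form N g s.
Proof.
move=> N0; elim: s => [|i s IH]; first by rewrite big1 // => j _; rewrite mulr0.
under eq_bigr do rewrite /= mulrDr mulrCA.
rewrite big_split /= -mulr_sumr IH [X in _ + X](bigD1 i) //= eqxx.
rewrite big1 => [|j /negPf->]; last by rewrite mulr0.
rewrite addr0 mulrBr [g i * (_ * _)]mulrCA -!exprS.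
rewrite !prednK ?max_form_degree_gt0 // max_form_degree_cons exprD.
by move: (g i ^+ _) => b; ring.
Qed.

Section MaxFormValuation.
Variables (I : eqType) (N : nat) (L : fieldType) (O : valuationRing L).
Variable g : I -> L.
Hypothesis gO : forall i, g i \in O.

Lemma max_form_valring s : max_form N g s \in O.
Proof.
elim: s => [|i s IH] /=; first exact: rpred0.
by rewrite rpredD ?rpredB ?rpredM ?rpredX.
Qed.

Lemma max_form_cofactor_valring s j : max_form_cofactor N g s j \in O.
Proof.
elim: s => [|i s IH] /=; first exact: rpred0.
rewrite rpredD ?rpredM ?max_form_valring //.
by case: (_ == _); rewrite ?rpred0 // rpredB ?rpredM ?rpredX ?max_form_valring.
Qed.

Hypothesis N_gt0 : (0 < N)%N.
Hypothesis gN : forall i, g i \notin max_ideal O -> g i ^+ N \in one_unit O.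

Lemma max_form_dichotomy s :
  if has (fun i => g i \notin max_ideal O) s then max_form N g s \in one_unit O
  else max_form N g s \in max_ideal O.
Proof.
elim: s => [|i s IH] /=; first exact: rpred0.
have := max_form_valring s; set a := max_form N g s in IH * => aO.
set d := max_form_degree N s; set b := g i ^+ d.
have bP :
    if g i \notin max_ideal O then b \in one_unit O else b \in max_ideal O.
  case: ifPn => [gi|/negPn gi]; first by rewrite /b exprM rpredX ?gN.
  by rewrite max_idealX ?max_form_degree_gt0.
have bO : b \in O by rewrite rpredX.
clearbody a b; have one_unitD x m : x \in one_unit O -> m \in max_ideal O ->
    x + m \in one_unit O.
  by rewrite !one_unitE addrAC; exact: rpredD.
have unitB x y : x \in one_unit O -> y \in one_unit O -> x - y \in max_ideal O.
  by move=> xu yu; have := rpredB xu yu; rewrite opprB addrA subrK.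
case: (has _ s) IH => aP; rewrite ?orbT ?orbF.
  have -> : a ^+ 2 - a * b + b ^+ 2 = a ^+ 2 + b * (b - a) by ring.
  apply: one_unitD; first exact: rpredX.
  case: ifP bP => _ bP; first by rewrite max_idealMl ?unitB.
  by rewrite max_idealMr ?rpredB.
have -> : a ^+ 2 - a * b + b ^+ 2 = b ^+ 2 + a * (a - b) by ring.
have abm : a * (a - b) \in max_ideal O by rewrite max_idealMr ?rpredB.
case: ifP bP => _ bP; first by rewrite one_unitD ?rpredX.
by rewrite rpredD // max_idealX.
Qed.

End MaxFormValuation.

(** * Local partitions of unity *)

Section Points.
Variables (K : fieldType) (V : valuationRing K).

(* A ring morphism ev : K[X] -> L stands for evaluation at ev 'X over the
   embedding of K into L that it induces. *)
Definition integral_point (n : nat) (L : fieldType) (O : {pred L})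
    (ev : {poly K} -> L) : Prop :=
  [/\ prolongs V (ev \o polyC) O, algebraic_deg_le n (ev \o polyC) (ev 'X)
    & ev 'X \in O].

Definition integral_valued (n : nat) (f : {poly K}) : Prop :=
  forall (L : fieldType) (ev : {rmorphism {poly K} -> L}) (O : valuationRing L),
    integral_point n O ev -> ev f \in O.

Lemma rmorph_comp_poly (L : fieldType) (ev : {rmorphism {poly K} -> L}) p q :
  ev (p \Po q) = (map_poly (ev \o polyC) p).[ev q].
Proof.
elim/poly_ind: p => [|p c IH]; first by rewrite comp_poly0 !rmorph0 horner0.
rewrite comp_poly_MXaddC !rmorphD !rmorphM /= map_polyX map_polyC !hornerE.
by rewrite IH.
Qed.

Lemma rmorph_poly (L : fieldType) (ev : {rmorphism {poly K} -> L}) p :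
  ev p = (map_poly (ev \o polyC) p).[ev 'X].
Proof. by rewrite -rmorph_comp_poly comp_polyXr. Qed.

Section Evaluation.
Variables (n : nat) (L : fieldType) (ev : {rmorphism {poly K} -> L}).
Hypothesis evn : algebraic_deg_le n (ev \o polyC) (ev 'X).

Lemma algebraic_deg_le_ev_ratio u v :
  ev v != 0 -> algebraic_deg_le n (ev \o polyC) (ev u / ev v).
Proof.
by have := algebraic_deg_le_ratio evn u (v := v); rewrite -!rmorph_poly.
Qed.

Lemma algebraic_deg_le_ev u : algebraic_deg_le n (ev \o polyC) (ev u).
Proof. by have := algebraic_deg_le_horner evn u; rewrite -rmorph_poly. Qed.

Variable O : valuationRing L.
Hypotheses (VO : prolongs V (ev \o polyC) O) (XO : ev 'X \in O).

Lemma ev_polyOver p : p \is a polyOver V -> ev p \in O.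
Proof.
by move=> pV; rewrite rmorph_poly rpred_horner // (prolongs_polyOver VO).
Qed.

End Evaluation.
End Points.

Lemma absorb_poles (L : fieldType) (O : valuationRing L) (w y c e : L)
    (k l m q : nat) :
  w != 0 -> w \in max_ideal O ->
  y / w ^+ l \in one_unit O -> e = 1 - y / w ^+ m ->
  (e \in max_ideal O -> e ^+ q / w \in O) ->
  c \in O -> ((l < m)%N -> c / w ^+ k \in O) ->
  c ^+ (m * q).+1 * e ^+ (q * k) \in O /\
  ((l < m.+1)%N -> c ^+ (m * q).+1 * e ^+ (q * k) / w ^+ k \in O).
Proof.
move=> w0 /max_ideal_sub wO yl eE eq cO ck.
have wX i : w ^+ i != 0 by rewrite expf_neq0.
have yO : y \in O.
  by rewrite -(divfK (wX l) y) rpredM ?rpredX ?(one_unit_sub yl).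
rewrite ltnS; have [lm|ml|lm] := ltngtP l m.
- have ceE : c ^+ (m * q).+1 * e ^+ (q * k) / w ^+ k =
      (c / w ^+ k) ^+ (m * q).+1 * (w ^+ m - y) ^+ (q * k).
    have -> : w ^+ m - y = e * w ^+ m by rewrite eE mulrBl mul1r divfK.
    rewrite expr_div_n exprMn -!exprM mulnA [(m * q * k)%N]mulnC mulnS exprD.
    have := wX k; have := wX (k * (m * q))%N.
    move: (w ^+ k) (w ^+ (k * (m * q))) => u v v0 u0.
    by field; rewrite u0 v0.
  have ceO : c ^+ (m * q).+1 * e ^+ (q * k) / w ^+ k \in O.
    by rewrite ceE rpredM // rpredX ?rpredB ?rpredX // ck.
  split=> //; rewrite -[X in X \in O](divfK (wX k)).
  by rewrite rpredM // rpredX.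
- have eO : e \in O.
    have yE : y / w ^+ m = y / w ^+ l * w ^+ (l - m).
      by rewrite -{1}(subnK (ltnW ml)) exprD invfM mulrA mulrAC divfK.
    rewrite eE rpredB ?rpred1 // yE.
    by rewrite rpredM ?rpredX ?(one_unit_sub yl).
  by split=> //; rewrite rpredM ?rpredX.
- have em : e \in max_ideal O by rewrite eE -lm -rpredN opprB -one_unitE.
  have eO := max_ideal_sub em.
  split=> [|_]; first by rewrite rpredM ?rpredX.
  by rewrite -mulrA exprM -expr_div_n rpredM ?rpredX // eq.
Qed.

Section LocalPartition.
Variables (K : fieldType) (V : valuationRing K) (pi : K).
Variables (T : finType) (rep : T -> K).
Hypotheses (Vpi : uniformizer V pi) (Vrep : residue_system V rep).
Variable n : nat.
Local Notation N := (expansion_exponent n #|T|).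

(* E is a product of powers of the 1 - X / pi^j, j < m; the exponents decrease
   fast enough for the small factor j = l to absorb the poles of the later
   ones. *)
Lemma exists_small_polynomial (k m : nat) : exists E : {poly K}, E.[0] = 1 /\
  forall (L : fieldType) (kappa : {rmorphism K -> L}) (O : valuationRing L)
      (y : L) (l : nat),
    prolongs V kappa O -> algebraic_deg_le n kappa y ->
    y / kappa pi ^+ l \in one_unit O ->
    (map_poly kappa E).[y] \in O /\
    ((l < m)%N -> (map_poly kappa E).[y] / kappa pi ^+ k \in O).
Proof.
elim: m => [|m [E [E0 IH]]].
  by exists 1; split=> [|L kappa O y l _ _ _]; rewrite ?rmorph1 hornerC ?rpred1.
pose e : {poly K} := 1 - (pi ^- m) *: 'X.
exists (E ^+ (m * N).+1 * e ^+ (N * k)); split.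
  by rewrite hornerM !horner_exp E0 /e !hornerE ?mulr0 ?subr0 !expr1n ?mul1r.
move=> L kappa O y l VO yn yl; have [EO Ek] := IH L kappa O y l VO yn yl.
have ey_alg := algebraic_deg_le_horner yn e.
have w0 := prolongs_uniformizer_neq0 kappa Vpi.
have wm := prolongs_uniformizer_max_ideal VO Vpi.
have eyE : (map_poly kappa e).[y] = 1 - y / kappa pi ^+ m.
  rewrite rmorphB rmorph1 /= map_polyZ map_polyX !hornerE.
  by rewrite fmorphV rmorphXn mulrC.
rewrite rmorphM !rmorphXn hornerM !horner_exp.
apply: (absorb_poles w0 wm yl eyE _ EO Ek) => em.
have [->|ey0] := eqVneq (map_poly kappa e).[y] 0.
  by rewrite expr0n gtn_eqF ?expansion_exponent_gt0 // mul0r rpred0.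
exact: (max_ideal_expansion Vpi Vrep VO ey_alg ey0).
Qed.

Variables (I : finType) (g : I -> {poly K}).
Local Notation form := (max_form N g (enum I)).
Local Notation cofactor := (max_form_cofactor N g (enum I)).
Local Notation D := (max_form_degree N (enum I)).

Section AtPoint.
Variables (L : fieldType) (ev : {rmorphism {poly K} -> L}).
Variable O : valuationRing L.
Hypothesis evP : integral_point V n O ev.
Variable j : I.
Hypotheses (gj0 : ev (g j) != 0) (dom : forall i, ev (g i) / ev (g j) \in O).
Local Notation ratio := (fun i => ev (g i) / ev (g j)).

Let evgE : ev \o g = fun i => ev (g j) * ratio i.
Proof. by apply/funext => i; rewrite mulrC divfK. Qed.

Lemma ev_max_form : ev form = ev (g j) ^+ D * max_form N ratio (enum I).
Proof. by rewrite rmorph_max_form evgE max_formM. Qed.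

Lemma ev_max_form_cofactor i :
  ev (cofactor i) = ev (g j) ^+ D.-1 * max_form_cofactor N ratio (enum I) i.
Proof.
rewrite rmorph_max_form_cofactor evgE max_form_cofactorM //.
exact: expansion_exponent_gt0.
Qed.

Lemma max_form_ratio_one_unit : max_form N ratio (enum I) \in one_unit O.
Proof.
have [VO evn _] := evP.
have := max_form_dichotomy dom (expansion_exponent_gt0 n #|T|).
move=> /(_ _ (enum I)); case: ifPn => [_|nohas]; last first.
  by case/hasP: nohas; exists j; rewrite ?mem_enum // divff // max_ideal1.
apply=> i im.
apply: (val_unit_expansion Vrep VO (algebraic_deg_le_ev_ratio evn _ gj0)).
by rewrite val_unitE dom.
Qed.

Lemma max_form_expansion k :
  ev (g j) \in O -> ev pi%:P ^+ k / ev (g j) \in O ->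
  exists2 l : nat, (l <= k * D)%N & ev form / ev pi%:P ^+ l \in one_unit O.
Proof.
move=> gjO kO; have [VO evn _] := evP.
have [l lk lu] :=
  one_unit_expansion_bound Vpi Vrep VO (algebraic_deg_le_ev evn _) gj0 gjO kO.
exists (l * 2 ^ size (enum I))%N.
  by rewrite /max_form_degree mulnA leq_mul2r lk orbT.
rewrite ev_max_form /max_form_degree (exprM _ N) (exprM _ l) mulrAC.
rewrite -expr_div_n; apply: rpredM; first exact: rpredX lu.
exact: max_form_ratio_one_unit.
Qed.

(* For E(0) = 1 and W = (1 - E) / X, this is the evaluation of a product
   Y_i g_i', where the Y_i come from the identity 1 = W(form) form + E(form). *)
Lemma ev_partition_term (E W b : {poly K}) (k : nat) i i' :
  (W \Po form) * form = 1 - (E \Po form) ->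
  ev ((cofactor i * (W \Po form) + pi ^- k *: (E \Po form) * b) * g i') =
    max_form_cofactor N ratio (enum I) i * ratio i'
      * (max_form N ratio (enum I))^-1 * (1 - ev (E \Po form)) +
    ev (E \Po form) / ev pi%:P ^+ k * ev b * ev (g i').
Proof.
move=> Wf; have F0 := one_unit_neq0 max_form_ratio_one_unit.
have D_gt0 : (0 < D)%N by rewrite max_form_degree_gt0 ?expansion_exponent_gt0.
have form0 : ev form != 0 by rewrite ev_max_form mulf_neq0 ?expf_neq0.
have Wev : ev (W \Po form) = (1 - ev (E \Po form)) / ev form.
  by apply: (mulIf form0); rewrite -rmorphM Wf rmorphB rmorph1 divfK.
rewrite -mul_polyC mulrDl !(rmorphM, rmorphD) /= Wev.
rewrite -[ev (pi ^- k)%:P]/((ev \o polyC) _) fmorphV rmorphXn.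
rewrite ev_max_form_cofactor ev_max_form -{2}(prednK D_gt0) exprSr.
move: (max_form _ _ _) F0 (expf_neq0 D.-1 gj0) => F F0.
move: (_ ^+ D.-1) => m m0; congr (_ + _); last by rewrite [_^-1 * _]mulrC.
by field; rewrite F0 m0 gj0.
Qed.

End AtPoint.

Variables (a : I -> {poly K}) (k : nat).
Hypothesis gV : forall i, g i \is a polyOver V.
Hypothesis aV : forall i, a i \is a polyOver V.
Hypothesis ag : \sum_i a i * g i = (pi ^+ k)%:P.

Lemma exists_dominant_value (L : fieldType) (ev : {rmorphism {poly K} -> L})
    (O : valuationRing L) : integral_point V n O ev ->
  exists j, [/\ ev (g j) != 0, forall i, ev (g i) / ev (g j) \in O
    & ev pi%:P ^+ k / ev (g j) \in O].
Proof.
move=> [VO _ XO].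
have w0 : ev pi%:P != 0 := prolongs_uniformizer_neq0 (ev \o polyC) Vpi.
have agE : \sum_i ev (a i) * ev (g i) = ev pi%:P ^+ k.
  rewrite -rmorphXn -polyC_exp -ag rmorph_sum.
  by apply: eq_bigr => i _; rewrite rmorphM.
have [i gi0] : exists i, ev (g i) != 0.
  apply: contrapT => g0; case/eqP: (expf_neq0 k w0).
  rewrite -agE big1 // => i _.
  have [->|gi0] := eqVneq (ev (g i)) 0; first by rewrite mulr0.
  by case: g0; exists i.
have [j gj0 dom] := dominant_term O (t := ev \o g) gi0.
exists j; split=> //; rewrite -agE mulr_suml rpred_sum // => l _.
by rewrite -mulrA rpredM ?dom // (ev_polyOver VO).
Qed.

Lemma local_partition : exists Y : I -> {poly K},
  \sum_i Y i * g i = 1 /\ forall i j, integral_valued V n (Y i * g j).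
Proof.
have [E [E0 E_small]] := exists_small_polynomial k (k * D).+1.
have /factor_theorem[W WE] : root (1 - E) 0 by rewrite /root !hornerE E0 subrr.
rewrite subr0 in WE.
have Wf : (W \Po form) * form = 1 - (E \Po form).
  by rewrite -{2}[form]comp_polyX -comp_polyM -WE comp_polyB rmorph1.
exists (fun i => cofactor i * (W \Po form) + pi ^- k *: (E \Po form) * a i).
split=> [|i i' L ev O evP].
  have -> W' E' : \sum_i (cofactor i * W' + E' * a i) * g i =
      W' * \sum_i g i * cofactor i + E' * \sum_i a i * g i.
    by rewrite !mulr_sumr -big_split; apply: eq_bigr => i _ /=; ring.
  have pik0 : pi ^+ k != 0 by rewrite expf_neq0 //; case: Vpi.
  rewrite ag max_form_sum ?expansion_exponent_gt0 // Wf [_ * _%:P]mulrC.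
  by rewrite mul_polyC scalerA mulfV // scale1r subrK.
have [VO evn XO] := evP; have [j [gj0 dom kO]] := exists_dominant_value evP.
have [l lk lu] := max_form_expansion evP gj0 dom (ev_polyOver VO XO (gV j)) kO.
have [EO] := E_small _ _ _ _ l VO (algebraic_deg_le_ev evn form) lu.
rewrite -rmorph_comp_poly in EO *.
move=> /(_ (leq_ltn_trans lk (ltnSn _))) Ek.
rewrite (ev_partition_term evP gj0 dom _ _ _ _ Wf) rpredD //; last first.
  by rewrite -mulrA rpredM // rpredM ?(ev_polyOver VO XO).
rewrite rpredM ?rpredB ?rpred1 //; apply: rpredM; last first.
  exact/one_unit_sub/rpredVr/(max_form_ratio_one_unit evP gj0 dom).
by apply: rpredM; [exact: max_form_cofactor_valring|exact: dom].
Qed.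

End LocalPartition.

(** * Polynomial functions of integral matrices *)

Lemma irreducible_divisor (K : fieldType) (p : {poly K}) : (1 < size p)%N ->
  exists2 r, irreducible_poly r & r %| p.
Proof.
have [m sm] := ubnP (size p); elim: m p sm => // m IH p sm p1.
have [pirr|nirr] := pselect (irreducible_poly p); first by exists p.
have [q [q1 qp nqp]] : exists q : {poly K},
    [/\ size q != 1%N, q %| p & ~~ (q %= p)].
  apply: contrapT => noq; apply: nirr; split=> // q q1 qp.
  by apply/negPn/negP => nqp; apply: noq; exists q.
have p0 : p != 0 by rewrite -size_poly_gt0 ltnW.
have q0 : q != 0 by apply: contraNneq p0 => q0; rewrite q0 dvd0p in qp.
have sqp : (size q < size p)%N.
  by rewrite ltn_neqAle dvdp_leq // andbT (dvdp_size_eqp qp).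
have [||r rirr rq] := IH q.
- by rewrite (leq_trans sqp).
- by rewrite ltn_neqAle eq_sym q1 size_poly_gt0.
by exists r; last exact: dvdp_trans qp.
Qed.

Lemma exists_splitting_field (K : fieldType) (p : {poly K}) : p != 0 ->
  exists (L : fieldType) (kappa : {rmorphism K -> L}) (s : seq L),
    map_poly kappa p %= \prod_(z <- s) ('X - z%:P).
Proof.
have [m sm] := ubnP (size p); elim: m K p sm => // m IH K p sm p0.
have [p1|p1] := leqP (size p) 1.
  exists K, idfun, [::]; rewrite map_poly_id // big_nil -size_poly_eq1.
  by rewrite eqn_leq p1 size_poly_gt0.
have [r rirr rp] := irreducible_divisor p1.
have [K1 _ [x rx _]] := irredp_FAdjoin rirr.
have /factor_theorem[q pq] : root (map_poly (in_alg K1) p) x.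
  by move/dvdpP: rp => [t ->]; rewrite rmorphM rootM rx orbT.
have q0 : q != 0.
  apply: contraNneq p0 => q0.
  by rewrite -(map_poly_eq0 (in_alg K1)) pq q0 mul0r.
have [|L [kappa [s qs]]] := IH K1 q _ q0.
  move: sm; rewrite -(size_map_poly (in_alg K1)) pq size_mul ?polyXsubC_eq0 //.
  by rewrite size_XsubC addn2.
exists L, (kappa \o in_alg K1), (kappa x :: s).
rewrite map_poly_comp pq rmorphM /= map_polyXsubC big_cons mulrC.
by rewrite eqp_mul2l ?polyXsubC_eq0.
Qed.

Lemma eigenvalue_horner_mx (L : fieldType) n (C : 'M[L]_n.+1) (f : {poly L})
    z s :
  char_poly C %| \prod_(x <- s) ('X - x%:P) ->
  eigenvalue (horner_mx C f) z ->
  exists2 x, root (char_poly C) x & z = f.[x].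
Proof.
move=> Cs /eigenvalueP[v vz v0].
have [m CE] := dvdp_prod_XsubC Cs.
have [[x xs fx]|nox] := pselect (exists2 x, x \in mask m s & f.[x] = z).
  by exists x => //; rewrite (eqp_root CE) root_prod_XsubC.
have cop : coprimep (f - z%:P) (char_poly C).
  rewrite (eqp_coprimepr _ CE) big_seq; elim/big_ind: _ => [|p q fp fq|x xs].
  - exact: coprimep1.
  - by rewrite coprimepMr fp.
  rewrite coprimep_XsubC; apply/negP; rewrite /root !hornerE subr_eq0.
  by move=> /eqP fx; apply: nox; exists x.
case/eqP: v0; apply/eqP; rewrite -submx0 -(mxdirect_kermxpoly C cop) sub_capmx.
rewrite (kermxpoly_min (mxminpoly_dvd_char C)) submx1 andbT.
apply/sub_kermxP; rewrite rmorphB /= horner_mx_C mulmxBr vz.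
by rewrite mul_mx_scalar subrr.
Qed.

Section IntegralValued.
Variables (K : fieldType) (V : valuationRing K) (pi : K).
Hypothesis Vpi : uniformizer V pi.

Lemma exists_prolongation (L : fieldType) (kappa : {rmorphism K -> L}) :
  exists O : valuationRing L, prolongs V kappa O.
Proof.
pose R0 : {pred L} := fun y => `[< exists2 c, c \in V & y = kappa c >].
have R0P y : reflect (exists2 c, c \in V & y = kappa c) (y \in R0).
  exact: asboolP.
have R0sub : subring_closed R0.
  split=> [|_ _ /R0P[a aV ->] /R0P[b bV ->]|_ _ /R0P[a aV ->] /R0P[b bV ->]].
  - by apply/R0P; exists 1; rewrite ?rpred1 ?rmorph1.
  - by apply/R0P; exists (a - b); rewrite ?rpredB ?rmorphB.
  - by apply/R0P; exists (a * b); rewrite ?rpredM ?rmorphM.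
pose R : subringClosed L := HB.pack R0 (GRing.isSubringClosed.Build L R0 R0sub).
have [pi0 pim _] := Vpi.
have [|O [RO piO]] := @exists_valuation_ring L R (kappa pi)^-1.
  move=> /integral_elt_mem_of_inv; rewrite invrK => piR.
  have /piR/R0P[c cV] : kappa pi \in R.
    by apply/R0P; exists pi; rewrite ?max_ideal_sub.
  rewrite -fmorphV => /fmorph_inj piVE; move: pim.
  by rewrite max_idealE (negPf pi0) piVE cV.
have VO c : c \in V -> kappa c \in O by move=> cV; apply/RO/R0P; exists c.
exists O => c; apply/idP/idP => [cO|/VO//]; apply: contraNT piO => cV.
have c0 : c != 0 by apply: contraNneq cV => ->; exact: rpred0.
have : c^-1 \in max_ideal V by rewrite max_idealE invrK cV orbT.
rewrite (max_ideal_uniformizer Vpi) => /VO cpiO.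
have -> : (kappa pi)^-1 = kappa c * kappa (c^-1 / pi).
  by rewrite -rmorphM mulrA divff // mul1r fmorphV.
exact: rpredM.
Qed.

Variables (n : nat) (f : {poly K}).
Hypothesis f_integral : integral_valued V n.+1 f.

(* Every root of the characteristic polynomial of f(C) is f(x) for an
   eigenvalue x of C. *)
Lemma char_poly_horner_mx_polyOver (C : 'M[K]_n.+1) :
  (forall i j, C i j \in V) -> char_poly (horner_mx C f) \is a polyOver V.
Proof.
move=> CV; have Cpoly : char_poly C \is a polyOver V.
  exact: char_poly_polyOver.
set psi := char_poly (horner_mx C f).
have psim : psi \is monic := char_poly_monic _.
have [|L [kappa [s ss]]] := @exists_splitting_field K (char_poly C * psi).
  by rewrite mulf_neq0 ?monic_neq0 ?char_poly_monic.
have [O VO] := exists_prolongation kappa.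
have Cs : char_poly (map_mx kappa C) %| \prod_(x <- s) ('X - x%:P).
  by rewrite -map_char_poly -(eqp_dvdr _ ss) rmorphM dvdp_mulr.
have [m psiE] : {m | map_poly kappa psi %= \prod_(x <- mask m s) ('X - x%:P)}.
  by apply: dvdp_prod_XsubC; rewrite -(eqp_dvdr _ ss) rmorphM dvdp_mull.
have root_int z : root (map_poly kappa psi) z -> z \in O.
  rewrite map_char_poly map_horner_mx -eigenvalue_root_char.
  move=> /(eigenvalue_horner_mx Cs)[x]; rewrite -map_char_poly => Cx ->.
  apply: (f_integral (ev := horner_eval x \o map_poly kappa)).
  split.
  - by move=> c; rewrite /= map_polyC /horner_eval hornerC VO.
  - exists (char_poly C); rewrite monic_neq0 ?char_poly_monic // size_char_poly.
    by split=> //; rewrite /root -rmorph_poly.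
  rewrite /= map_polyX /horner_eval hornerX; apply: valring_integral_elt.
  exists (map_poly kappa (char_poly C)).
  by rewrite map_monic char_poly_monic (prolongs_polyOver VO).
have psiO : map_poly kappa psi \is a polyOver O.
  have -> : map_poly kappa psi = \prod_(x <- mask m s) ('X - x%:P).
    by apply/eqP; rewrite -eqp_monic ?map_monic ?monic_prod_XsubC.
  rewrite big_seq; apply: rpred_prod => z zs; rewrite polyOverXsubC root_int //.
  by rewrite (eqp_root psiE) root_prod_XsubC.
by apply/polyOverP => i; rewrite -VO -coef_map; exact: (polyOverP psiO).
Qed.
End IntegralValued.
(** * Integrality over a local ring of integer-valued polynomials *)

Section HornerAlg.
Variables (R : comNzRingType) (B : algType R).

Lemma horner_alg_comp (b : B) (p q : {poly R}) :
  horner_alg b (p \Po q) = horner_alg (horner_alg b q) p.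
Proof.
elim/poly_ind: p => [|p c IH]; first by rewrite comp_poly0 !rmorph0.
by rewrite comp_poly_MXaddC !rmorphD !rmorphM /= IH horner_algX !horner_algC.
Qed.

Variables (n : nat) (G : 'I_n.+1 -> B).

Lemma horner_alg_horner_mx (b : B) (C : 'M[R]_n.+1) :
  (forall i, b * G i = \sum_j C i j *: G j) ->
  forall (p : {poly R}) i,
    horner_alg b p * G i = \sum_j horner_mx C p i j *: G j.
Proof.
move=> bG; elim/poly_ind => [|p c IH] i.
  by rewrite !rmorph0 mul0r big1 // => j _; rewrite mxE scale0r.
rewrite rmorphD rmorphM /= horner_algX horner_algC mulrDl -mulrA bG.
rewrite [p * 'X]mulrC rmorphD rmorphM /= horner_mx_X horner_mx_C mulr_algl.
under [RHS]eq_bigr do rewrite !mxE scalerDl.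
rewrite big_split /=; congr (_ + _); last first.
  rewrite (bigD1 i) //= eqxx mulr1n big1 ?addr0 // => j ji.
  by rewrite eq_sym (negPf ji) mulr0n scale0r.
rewrite [LHS]mulr_sumr; under [LHS]eq_bigr do rewrite -scalerAr IH scaler_sumr.
rewrite exchange_big /=; apply: eq_bigr => j _; rewrite scaler_suml.
by apply: eq_bigr => k _; rewrite scalerA.
Qed.

Lemma char_poly_annihilates (b : B) (C : 'M[R]_n.+1) (e : 'I_n.+1 -> R) :
  1 = \sum_i e i *: G i -> (forall i, b * G i = \sum_j C i j *: G j) ->
  horner_alg b (char_poly C) = 0.
Proof.
move=> span1 bG; rewrite -[LHS]mulr1 span1 mulr_sumr big1 // => i _.
rewrite -scalerAr (horner_alg_horner_mx bG) Cayley_Hamilton.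
by rewrite big1 ?scaler0 // => j _; rewrite mxE scale0r.
Qed.

End HornerAlg.

Definition subalgebra_over (K : fieldType) (B : algType K) (V : {pred K})
    (S : set B) : Prop :=
  [/\ S 1, forall x y, S x -> S y -> S (x + y),
      forall x y, S x -> S y -> S (x * y)
    & forall c x, c \in V -> S x -> S (c *: x)].

Section MonicCompIntK.
Variables (K : fieldType) (V : valuationRing K) (pi : K).
Variables (T : finType) (rep : T -> K).
Hypotheses (Vpi : uniformizer V pi) (Vrep : residue_system V rep).
Variable n : nat.

(* The factor 'X only matters for n = 0, where it keeps the degree positive. *)
Definition residue_product : {poly K} :=
  'X * \prod_(c : {ffun 'I_n -> T}) ('X^n + residue_poly rep c).

Lemma monic_residue_poly (c : {ffun 'I_n -> T}) :
  'X^n + residue_poly rep c \is monic.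
Proof.
rewrite monicE lead_coefDl ?lead_coefXn // size_polyXn ltnS.
exact: size_residue_poly.
Qed.

Lemma monic_residue_poly_polyOver (c : {ffun 'I_n -> T}) :
  'X^n + residue_poly rep c \is a polyOver V.
Proof. by rewrite rpredD ?rpredX ?polyOverX ?(residue_poly_polyOver Vrep). Qed.

Lemma residue_product_monic : residue_product \is monic.
Proof.
rewrite monicMl ?monicX // monic_prod // => c _.
exact: monic_residue_poly.
Qed.

Lemma residue_product_polyOver : residue_product \is a polyOver V.
Proof.
rewrite rpredM ?polyOverX // rpred_prod // => c _.
exact: monic_residue_poly_polyOver.
Qed.

Lemma size_residue_product : (1 < size residue_product)%N.
Proof.
rewrite /residue_product mulrC size_mulX ?ltnS ?size_poly_gt0 monic_neq0 //;
  by apply: monic_prod => c _; exact: monic_residue_poly.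
Qed.

Lemma residue_product_mod_uniformizer psi :
  psi \is monic -> psi \is a polyOver V -> size psi = n.+1 ->
  exists s t, [/\ s \is a polyOver V, t \is a polyOver V
    & residue_product = psi * s + pi *: t].
Proof.
move=> psim psiV spsi; have pi0 : pi != 0 by case: Vpi.
have [|c cm] := residue_poly_approx Vrep _ (size_monicB_Xn psim spsi).
  by rewrite rpredB ?rpredX ?polyOverX.
pose s := 'X * \prod_(d | d != c) ('X^n + residue_poly rep d).
have sV : s \is a polyOver V.
  rewrite rpredM ?polyOverX // rpred_prod // => d _.
  exact: monic_residue_poly_polyOver.
pose r := pi^-1 *: (psi - 'X^n - residue_poly rep c).
have rV : r \is a polyOver V.
  apply/polyOverP => i; rewrite coefZ mulrC -(max_ideal_uniformizer Vpi).
  exact: (polyOverP cm).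
exists s, (- (r * s)); split=> //; first by rewrite rpredN rpredM.
rewrite /residue_product (bigD1 c) //= mulrCA -/s scalerN.
have -> : 'X^n + residue_poly rep c = psi - pi *: r.
  by rewrite scalerA divff // scale1r; ring.
by rewrite mulrBl scalerAl.
Qed.

Variables (B : algType K) (S : set B).
Hypothesis SV : subalgebra_over V S.

Lemma subalgebra0 : S 0.
Proof.
have [S1 _ _ SZ] := SV.
by rewrite -(scale0r 1); apply: SZ => //; exact: rpred0.
Qed.

Lemma subalgebra_horner_alg b p :
  S b -> p \is a polyOver V -> S (horner_alg b p).
Proof.
have [S1 SD SM SZ] := SV.
move=> Sb; elim/poly_ind: p => [|p c IH] pcV.
  by rewrite rmorph0; exact: subalgebra0.
have [pV cV] := polyOver_MXaddC pcV.
rewrite rmorphD rmorphM /= horner_algX horner_algC.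
by apply: SD; [apply: SM => //; exact: IH|exact: SZ].
Qed.

Lemma subalgebra_horner_alg_denominator c y psi p :
  psi \is monic -> psi \is a polyOver V -> size psi = n.+1 ->
  horner_alg y psi = 0 -> (forall i, (i < n)%N -> S (c *: y ^+ i)) ->
  p \is a polyOver V -> S (c *: horner_alg y p).
Proof.
have [S1 SD SM SZ] := SV.
move=> psim psiV spsi psiy Sy pV.
have [_ rV] := divp_modp_monic_polyOver psim psiV pV.
have sr : (size (p %% psi)%R <= n)%N by rewrite -ltnS -spsi ltn_modp monic_neq0.
rewrite (divp_eq p psi) rmorphD rmorphM /= psiy mulr0 add0r.
rewrite (poly_sum_wide sr) linear_sum scaler_sumr.
elim/big_ind: _ => [||i _]; [exact: subalgebra0|exact: SD|].
rewrite linearZ rmorphXn /= horner_algX mulr_algl scalerA mulrC -scalerA.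
by apply: SZ; [exact: (polyOverP rV)|exact: Sy].
Qed.

(* A high enough power of the product of all monic polynomials of degree n over
   the residue field absorbs the denominators of f. *)
Lemma exists_monic_comp_IntK f :
  (forall b, S b -> exists psi, [/\ psi \is monic, psi \is a polyOver V,
     size psi = n.+1 & horner_alg (horner_alg b f) psi = 0]) ->
  exists phi, [/\ phi \is monic, phi \is a polyOver V, (1 < size phi)%N
    & IntK S (phi \Po f)].
Proof.
have [S1 SD SM SZ] := SV.
move=> f_integral; have piV := uniformizer_mem Vpi.
have [k /(_ tt) kV] := uniformizer_clear_denominators Vpi (fun _ : unit => f).
pose m := (k * n)%N; exists (residue_product ^+ m.+1); split.
- exact: monic_exp residue_product_monic.
- by rewrite rpredX ?residue_product_polyOver.
- by rewrite -ltn_predRL size_exp muln_gt0 ltn_predRL size_residue_product.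
move=> b Sb; have [psi [psim psiV spsi psiy]] := f_integral b Sb.
have [s [t [sV tV ->]]] := residue_product_mod_uniformizer psim psiV spsi.
rewrite horner_alg_comp rmorphXn rmorphD rmorphM /= psiy mul0r add0r.
rewrite linearZ /= mulr_algl exprZn -rmorphXn exprS -scalerA; apply: (SZ) => //.
apply: (subalgebra_horner_alg_denominator psim) => // [i ilt|]; last first.
  exact: rpredX.
have -> : pi ^+ m *: horner_alg b f ^+ i =
    pi ^+ (k * (n - i)) *: horner_alg b (pi ^+ k *: f) ^+ i.
  rewrite linearZ /= mulr_algl exprZn -exprM scalerA -exprD -mulnDr subnK //.
  exact: ltnW.
apply: SZ; first exact: rpredX.
rewrite -rmorphXn; apply: subalgebra_horner_alg => //; exact: rpredX.
Qed.

End MonicCompIntK.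
(** * Localization of an almost Dedekind domain at a maximal ideal *)

Section MaximalIdeals.
Variable D : idomainType.

Lemma idealr_closed_bigcup (F : set (set D)) : F !=set0 ->
  (forall X, F X -> idealr_closed [in X]) -> total_on F subset ->
  idealr_closed [in \bigcup_(X in F) X].
Proof.
move=> [X0 FX0] FI Ftot; split=> [||c x y]; rewrite ?in_setE.
- by exists X0 => //; have [] := FI _ FX0; rewrite in_setE.
- apply/negP; rewrite in_setE => -[X FX X1].
  by have [_ /negP[]] := FI X FX; rewrite in_setE.
apply: (bigcup_chain_closed2 (op := fun u v => c * u + v) Ftot) => X FX u v.
by have [_ _ /(_ c u v)] := FI X FX; rewrite !in_setE.
Qed.

Lemma exists_maximal_ideal (I : set D) : idealr_closed [in I] ->
  exists2 M : idealr D, maximal_ideal M & forall x, I x -> x \in M.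
Proof.
move=> Iid.
have [||A [Aid IA] Amax] := @Zorn_bigcup_nonempty D
    [set A : set D | idealr_closed [in A] /\ I `<=` A] I.
- by split.
- move=> F F0 FP Ftot; split.
    by apply: idealr_closed_bigcup => // X /FP[].
  by have [X FX] := F0; move=> x Ix; exists X => //; have [_] := FP X FX; exact.
pose M : idealr D := HB.pack [in A] (isIdealr.Build D [in A] Aid).
have ME x : (x \in M) = (x \in A) by [].
exists M; last by move=> x /IA; rewrite ME in_setE.
move=> J MJ x xJ; rewrite ME; apply/negPn/negP => xA.
have AJ : A `<=` [set y | y \in J].
  by move=> y Ay; apply: MJ; rewrite ME in_setE.
apply: (Amax [set y | y \in J]).
  by split=> // JA; move/negP: xA; apply; rewrite in_setE; exact: JA.
split; last by move=> y /IA /AJ.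
split=> [||c u v]; rewrite ?in_setE /=; first exact: rpred0.
  by apply/negP; rewrite in_setE /= idealr1.
by move=> uJ vJ; rewrite rpredD // idealMr.
Qed.

Variable M : idealr D.
Hypothesis Mmax : maximal_ideal M.

Lemma maximal_ideal_inverse s : s \notin M -> exists t, 1 - t * s \in M.
Proof.
move=> sM; apply: contrapT => noinv.
pose C : {pred D} := fun x => `[< exists t, x - t * s \in M >].
have CP x : reflect (exists t, x - t * s \in M) (x \in C) by exact: asboolP.
have Cid : idealr_closed C.
  split=> [||c u v /CP[t ut] /CP[t' vt']].
  - by apply/CP; exists 0; rewrite mul0r subrr rpred0.
  - by apply/negP => /CP.
  apply/CP; exists (c * t + t').
  have -> : c * u + v - (c * t + t') * s = c * (u - t * s) + (v - t' * s).
    by ring.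
  by rewrite rpredD // idealMr.
pose J : idealr D := HB.pack C (isIdealr.Build D C Cid).
move/negP: sM; apply; apply: (Mmax (J := J)).
  by move=> x xM; apply/CP; exists 0; rewrite mul0r subr0.
by apply/CP; exists 1; rewrite mul1r subrr rpred0.
Qed.

Lemma maximal_ideal_prime : prime_idealr_closed M.
Proof.
move=> u v uvM; apply/orP.
have [uM|/maximal_ideal_inverse[t tM]] := boolP (u \in M); first by left.
right; have -> : v = v * (1 - t * u) + t * (u * v) by ring.
by rewrite rpredD // idealMr.
Qed.

End MaximalIdeals.

Lemma exists_maximal_prime_ideal (D : idomainType) (I : set D) :
  idealr_closed [in I] ->
  exists2 M : prime_idealr D, maximal_ideal M & forall x, I x -> x \in M.
Proof.
move=> /exists_maximal_ideal[M Mmax IM].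
have Mprime := maximal_ideal_prime Mmax.
pose Mp : prime_idealr D :=
  HB.pack (M : D -> bool) M (isPrimeIdealrClosed.Build D M Mprime).
by exists Mp.
Qed.

Section NormalizedValuation.
Variables (K : fieldType) (v : K -> int).
Hypothesis v_norm : normalized_valuation v.

Lemma valuationM x y : x != 0 -> y != 0 -> v (x * y) = v x + v y.
Proof. by case: v_norm => vM _ _; exact: vM. Qed.

Lemma valuation1 : v 1 = 0.
Proof.
by apply: (addrI (v 1)); rewrite -valuationM ?oner_neq0 // mulr1 addr0.
Qed.

Lemma valuationV x : x != 0 -> v x^-1 = - v x.
Proof.
move=> x0; apply: (addrI (v x)).
by rewrite -valuationM ?invr_eq0 // divff // valuation1 subrr.
Qed.

Lemma valuationXn x n : x != 0 -> v (x ^+ n) = v x *+ n.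
Proof.
move=> x0; elim: n => [|n IH]; first exact: valuation1.
by rewrite exprS valuationM ?expf_neq0 // IH mulrS.
Qed.

Lemma valuationXz x (l : int) : x != 0 -> v (x ^ l) = v x *~ l.
Proof.
move=> x0; case: l => l; first by rewrite -exprnP valuationXn.
by rewrite NegzE -exprnN valuationV ?expf_neq0 // valuationXn // mulrNz.
Qed.

Lemma valuationN x : x != 0 -> v (- x) = v x.
Proof.
move=> x0; have n0 : - x != 0 by rewrite oppr_eq0.
have := valuationXn 2 n0; rewrite sqrrN valuationXn // => /esym.
exact: pmulrnI.
Qed.

Definition valuation_pred : {pred K} := fun x => (x == 0) || (0 <= v x).

Fact valuation_pred_subring_closed : subring_closed valuation_pred.
Proof.
have [_ vD _] := v_norm.
split=> [|x y|x y]; rewrite !unfold_in; first by rewrite valuation1 lexx orbT.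
- have [->|x0] := eqVneq x 0.
    by rewrite sub0r oppr_eq0; case: eqVneq => //= y0; rewrite valuationN.
  have [->|y0] := eqVneq y 0; first by rewrite subr0 (negPf x0).
  case: eqVneq => //= xy vx vy; apply: le_trans (vD x (- y) _ _ _) => //.
    by rewrite valuationN // le_min vx vy.
  by rewrite oppr_eq0.
- rewrite mulf_eq0; have [->|x0] := eqVneq x 0 => //=.
  have [->|y0] := eqVneq y 0 => //= vx vy.
  by rewrite valuationM // addr_ge0.
Qed.

Fact valuation_pred_total x :
  (x \in valuation_pred) || (x^-1 \in valuation_pred).
Proof.
rewrite !unfold_in invr_eq0; have [//|x0] := eqVneq x 0.
by rewrite /= valuationV // oppr_ge0 le_total.
Qed.

Lemma normalized_valuation_uniformizer : exists (V : valuationRing K) (pi : K),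
  uniformizer V pi /\ forall x, x \in V <-> valuation_ring_of v x.
Proof.
have [_ _ [pi pi0 vpi]] := v_norm.
pose V : valuationRing K := HB.pack valuation_pred
  (GRing.isSubringClosed.Build K valuation_pred valuation_pred_subring_closed)
  (isValuationRing.Build K valuation_pred valuation_pred_total).
have VE x : x != 0 -> (x \in V) = (0 <= v x).
  by move=> x0; rewrite unfold_in (negPf x0).
exists V, pi; split; last first.
  move=> x; have [->|x0] := eqVneq x 0.
    by split=> _; [left|exact: rpred0].
  by rewrite VE //; split=> [|[/eqP|//]]; [right|rewrite (negPf x0)].
split=> //; first by rewrite max_idealE VE ?invr_eq0 // valuationV // vpi orbT.
move=> x x0; exists (v x); apply/val_unitP.
have u0 : x / pi ^ v x != 0 by rewrite mulf_neq0 ?invr_eq0 ?expfz_neq0.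
have vu : v (x / pi ^ v x) = 0.
  rewrite valuationM ?invr_eq0 ?expfz_neq0 // valuationV ?expfz_neq0 //.
  by rewrite valuationXz // vpi intz subrr.
by rewrite !VE ?invr_eq0 // valuationV // vu oppr0.
Qed.

End NormalizedValuation.

Section LocalRing.
Variables (D : idomainType) (M : prime_idealr D).
Local Notation K := {fraction D}.

Lemma notin_prime_neq0 s : s \notin M -> s%:F != 0 :> K.
Proof.
by move=> sM; rewrite tofrac_eq0; apply: contraNneq sM => ->; rewrite rpred0.
Qed.

Lemma notin_primeM s t : s \notin M -> t \notin M -> s * t \notin M.
Proof. by move=> sM tM; rewrite prime_idealrM negb_or sM. Qed.

Lemma notin_prime_prod (I : finType) (P : pred I) (s : I -> D) :
  (forall i, s i \notin M) -> \prod_(i | P i) s i \notin M.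
Proof.
move=> sM; elim/big_ind: _ => [|x y|i _]; last exact: sM.
  by rewrite idealr1.
exact: notin_primeM.
Qed.

Section Localize.
Variables (W : lmodType K) (S : set W).

Lemma localizeP x : localize M S x <-> exists2 s, s \notin M & S (s%:F *: x).
Proof.
split=> [[s [m [sM Sm ->]]]|[s sM Ssx]].
  by exists s => //; rewrite scalerA mulfV ?scale1r ?notin_prime_neq0.
exists s, (s%:F *: x); split=> //.
by rewrite scalerA mulVf ?scale1r ?notin_prime_neq0.
Qed.

Lemma sub_localize : S `<=` localize M S.
Proof.
move=> x Sx; apply/localizeP.
by exists 1; rewrite ?idealr1 // tofrac1 scale1r.
Qed.

Hypothesis SZ : forall (d : D) x, S x -> S (d%:F *: x).

Lemma localize_family (I : finType) (x : I -> W) :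
  (forall i, localize M S (x i)) ->
  exists2 s, s \notin M & forall i, S (s%:F *: x i).
Proof.
move=> Sx; have /fin_all_exists2[s sM sS] i := (localizeP (x i)).1 (Sx i).
exists (\prod_i s i) => [|i]; first exact: notin_prime_prod.
by rewrite (bigD1 i) //= mulrC tofracM -scalerA; exact: SZ.
Qed.

Hypothesis SD : forall x y, S x -> S y -> S (x + y).

Lemma localize_add x y :
  localize M S x -> localize M S y -> localize M S (x + y).
Proof.
move=> /localizeP[s sM Sx] /localizeP[t tM Sy]; apply/localizeP.
exists (s * t); first exact: notin_primeM.
have := SD (SZ t Sx) (SZ s Sy); rewrite !scalerA -!tofracM scalerDr.
by rewrite [t * s]mulrC.
Qed.

End Localize.

Lemma local_ringP (x : K) :
  local_ring M x <-> exists2 s, s \notin M & exists d, d%:F = s%:F * x.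
Proof.
split=> [/localizeP[s sM [d _ dE]]|[s sM [d dE]]].
  by exists s => //; exists d.
by apply/localizeP; exists s => //; exists d.
Qed.

Lemma localize_scale (W : lmodType K) (S : set W) c x :
  (forall (d : D) y, S y -> S (d%:F *: y)) ->
  local_ring M c -> localize M S x -> localize M S (c *: x).
Proof.
move=> SZ /local_ringP[s sM [d dE]] /localizeP[t tM Sx]; apply/localizeP.
exists (s * t); first exact: notin_primeM.
by have := SZ d _ Sx; rewrite dE !scalerA tofracM [_ * c * _]mulrAC.
Qed.

Hypothesis Mmax : maximal_ideal M.
Variable V : valuationRing K.
Hypothesis V_local : forall x, x \in V <-> local_ring M x.

Lemma maximal_ideal_local d : d \in M -> d%:F \in max_ideal V.
Proof.
move=> dM; rewrite max_idealE; have [//|d0] := eqVneq d%:F 0; apply/negP.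
move=> /V_local/local_ringP[s sM [e eE]]; move/negP: sM; apply.
have -> : s = e * d.
  by apply/eqP; rewrite -tofrac_eq tofracM eE divfK.
exact: idealMr.
Qed.

Lemma local_ring_residue_system : finite_set [set: {ideal_quot M}] ->
  exists (T : finType) (rep : T -> K), residue_system V rep.
Proof.
move=> /finite_seqP[qs qsE].
exists (seq_sub qs), (fun t => (repr (val t))%:F).
split=> [t|x /V_local/local_ringP].
  apply/V_local/local_ringP; exists 1; rewrite ?idealr1 // tofrac1 mul1r.
  by exists (repr (val t)).
move=> [s sM [d dE]]; have [t tM] := maximal_ideal_inverse Mmax sM.
pose y : {ideal_quot M} := (\pi_{ideal_quot M} (d * t))%qT.
have yqs : y \in qs by have : [set` qs] y by rewrite -qsE.
exists (SeqSub yqs) => /=.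
have yM : d * t - repr y \in M by rewrite Quotient.idealrBE reprK.
have s0 := notin_prime_neq0 sM.
have -> : x - (repr y)%:F = (d * t - repr y)%:F + (1 - t * s)%:F * x.
  by rewrite !(tofracB, tofracM) tofrac1 dE; ring.
rewrite rpredD ?max_idealMr ?maximal_ideal_local //.
by apply/V_local/local_ringP; exists s => //; exists d.
Qed.

End LocalRing.
(** * Integrally closed domains *)

Lemma fraction_num_den (D : idomainType) (x : {fraction D}) :
  exists2 b : D, b != 0 & exists a : D, a%:F = b%:F * x.
Proof.
elim/quotW: x => r; exists \d_r; first exact: denom_ratioP.
exists \n_r; have d0 := denom_ratioP r; rewrite !piE; apply/eqmodP.
rewrite /= FracField.equivfE /FracField.mulf.
by rewrite !numden_Ratio ?mulf_neq0 ?oner_eq0 // !mul1r mulrC.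
Qed.

Definition homogenize (R : comNzRingType) (p : {poly R}) (a b : R) : R :=
  \sum_(i < size p) p`_i * a ^+ i * b ^+ ((size p).-1 - i).

Lemma rmorph_homogenize (R S : comNzRingType) (phi : {rmorphism R -> S})
    (p : {poly R}) (a b : R) (x : S) : phi a = phi b * x ->
  phi (homogenize p a b) = phi b ^+ (size p).-1 * (map_poly phi p).[x].
Proof.
move=> ax; rewrite (@horner_coef_wide _ (size p)) ?size_poly //.
rewrite mulr_sumr rmorph_sum; apply: eq_bigr => i _.
rewrite coef_map !rmorphM !rmorphXn ax exprMn /=.
have ip : (i <= (size p).-1)%N by rewrite -ltnS (ltn_predK (ltn_ord i)).
have -> : phi b ^+ (size p).-1 = phi b ^+ ((size p).-1 - i) * phi b ^+ i.
  by rewrite -exprD subnK.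
by move: (phi b ^+ _) (phi b ^+ _) (x ^+ _) => u v y; ring.
Qed.

(* An integral equation for x is transported to the fraction field of R by
   clearing denominators. *)
Lemma integrally_closed_fraction (R S : idomainType) (phi : {rmorphism R -> S})
    (a b : R) (x : S) : integrally_closed R -> injective phi ->
  b != 0 -> phi a = phi b * x -> integralOver phi x -> exists r, x = phi r.
Proof.
move=> Ric phi_inj b0 ax [p pm /eqP px].
have b0F : b%:F != 0 :> {fraction R} by rewrite tofrac_eq0.
have hom0 : homogenize p a b = 0.
  by apply: phi_inj; rewrite (rmorph_homogenize p ax) px mulr0 rmorph0.
have abF : a%:F = b%:F * (a%:F / b%:F) :> {fraction R} by rewrite mulrC divfK.
have [|r rE] := Ric (a%:F / b%:F).
  exists p => //; have /eqP := rmorph_homogenize p abF.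
  by rewrite hom0 rmorph0 eq_sym mulf_eq0 expf_eq0 (negPf b0F) andbF.
exists r; have phib0 : phi b != 0 by rewrite -(rmorph0 phi) (inj_eq phi_inj).
apply: (mulfI phib0); rewrite -ax -rmorphM; congr (phi _); apply/eqP.
by rewrite -tofrac_eq tofracM -rE mulrC divfK.
Qed.

Section ScaleRoots.
Variables (R : comNzRingType) (c : R) (q : {poly R}).
Hypothesis q_monic : q \is monic.

Definition scale_roots : {poly R} :=
  \poly_(i < size q) (c ^+ ((size q).-1 - i) * q`_i).

Lemma scale_roots_monic : scale_roots \is monic.
Proof.
have q_gt0 : (0 < size q)%N by rewrite size_poly_gt0 monic_neq0.
have lead1 : c ^+ ((size q).-1 - (size q).-1) * q`_(size q).-1 = 1.
  by rewrite subnn mul1r -lead_coefE (monicP q_monic).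
have sE : size scale_roots = size q by rewrite size_poly_eq // lead1 oner_eq0.
by rewrite monicE lead_coefE sE coef_poly ltn_predL q_gt0 lead1.
Qed.

Lemma scale_roots_polyOver (S : subringClosed R) :
  c \in S -> (forall i, (i < size q)%N -> c * q`_i \in S) ->
  scale_roots \is a polyOver S.
Proof.
move=> cS qS; apply/polyOver_poly => i iq.
have [id|di] := ltnP i (size q).-1.
  by rewrite -(subnSK id) exprSr -mulrA rpredM ?rpredX ?qS.
have -> : i = (size q).-1.
  by apply/eqP; rewrite eqn_leq di -ltnS (ltn_predK iq) iq.
by rewrite subnn mul1r -lead_coefE (monicP q_monic) rpred1.
Qed.

Lemma root_scale_roots x : root q x -> root scale_roots (c * x).
Proof.
move=> /eqP qx; rewrite /root horner_poly.
have -> : \sum_(i < size q) c ^+ ((size q).-1 - i) * q`_i * (c * x) ^+ i =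
    c ^+ (size q).-1 * q.[x].
  rewrite horner_coef mulr_sumr; apply: eq_bigr => i _.
  have id : (i <= (size q).-1)%N by rewrite -ltnS (ltn_predK (ltn_ord i)).
  have -> : c ^+ (size q).-1 = c ^+ ((size q).-1 - i) * c ^+ i.
    by rewrite -exprD subnK.
  by rewrite exprMn mulrACA !mulrA.
by rewrite qx mulr0.
Qed.

End ScaleRoots.

(** * The ring of integer-valued polynomials *)

Section IntKRing.
Variables (D : idomainType) (A : algType D) (B : algType {fraction D}).
Variable iota : {rmorphism A -> B}.
Hypothesis iota_loc : is_scalar_localization iota.
Local Notation K := {fraction D}.
Local Notation Int := (IntK_pred iota).

Lemma scalar_localizationZ d a : iota (d *: a) = d%:F *: iota a.
Proof. by case: iota_loc. Qed.

Lemma mem_IntK f : f \in Int <-> IntK (range iota) f.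
Proof. by split=> [/set_mem|fI]; last exact: mem_set. Qed.

Lemma IntK_const (d : D) : (d%:F)%:P \in Int.
Proof.
apply/IntK_predP => a; exists (d *: 1).
by rewrite scalar_localizationZ rmorph1 horner_algC.
Qed.

Lemma IntK_X : 'X \in Int.
Proof. by apply/IntK_predP => a; exists a; rewrite horner_algX. Qed.

Lemma IntK_scale (d : D) f : f \in Int -> d%:F *: f \in Int.
Proof. by move=> fI; rewrite -mul_polyC rpredM ?IntK_const. Qed.

Lemma IntK_clear_denominators f : exists2 d : D, d != 0 & d%:F *: f \in Int.
Proof.
elim/poly_ind: f => [|p c [d d0 dp]].
  by exists 1; rewrite ?oner_eq0 // scaler0 rpred0.
have [b b0 [a aE]] := fraction_num_den c.
exists (d * b); first by rewrite mulf_neq0.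
rewrite tofracM scalerDr rpredD //.
  by rewrite scalerAl [d%:F * _]mulrC -scalerA rpredM ?IntK_X // IntK_scale.
by rewrite -mul_polyC -polyCM -mulrA -aE -tofracM; exact: IntK_const.
Qed.

Lemma IntK_rangeZ (d : D) f :
  IntK (range iota) f -> IntK (range iota) (d%:F *: f).
Proof. by move=> /mem_IntK fI; apply/mem_IntK; exact: IntK_scale. Qed.

Lemma IntK_rangeD f g :
  IntK (range iota) f -> IntK (range iota) g -> IntK (range iota) (f + g).
Proof. by move=> /mem_IntK fI /mem_IntK gI; apply/mem_IntK; exact: rpredD. Qed.

Hypothesis Int_closed : integrally_closed (IntK_ring iota).

Lemma IntK_integral f :
  integralOver (val : IntK_ring iota -> {poly K}) f -> f \in Int.
Proof.
move=> fint; have [d d0 dI] := IntK_clear_denominators f.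
pose a : IntK_ring iota := Sub (d%:F *: f) dI.
pose b : IntK_ring iota := Sub (d%:F)%:P (IntK_const d).
have [||r ->] :=
    integrally_closed_fraction (a := a) (b := b) Int_closed val_inj _ _ fint.
- by rewrite -(inj_eq val_inj) rmorph0 /= polyC_eq0 tofrac_eq0.
- by rewrite /= mul_polyC.
exact: valP.
Qed.

Lemma IntK_integral_root (q : {poly {poly K}}) f :
  q \is monic -> q \is a polyOver Int -> root q f -> f \in Int.
Proof.
move=> qm /polyOverP qI qf; apply: IntK_integral.
apply: (integral_root_monic qm qf); apply/integral_poly => i.
exact: (integral_id _ (Sub q`_i (qI i) : IntK_ring iota)).
Qed.

Variable M : prime_idealr D.
Local Notation IntM := (localize M (IntK (range iota))).

Lemma IntK_localizeP g : IntM g <-> exists2 s, s \notin M & s%:F *: g \in Int.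
Proof. by rewrite localizeP; split=> -[s sM /mem_IntK]; exists s. Qed.

Lemma localize_IntK_integral (q : {poly {poly K}}) f :
  q \is monic -> (forall i, IntM q`_i) -> root q f -> IntM f.
Proof.
move=> qm qI qf.
have [s sM sI] := localize_family IntK_rangeZ (fun i : 'I_(size q) => qI i).
apply/IntK_localizeP; exists s => //; rewrite -mul_polyC.
apply: (IntK_integral_root (scale_roots_monic _ qm)); last first.
  exact: root_scale_roots.
apply: (scale_roots_polyOver qm (IntK_const s)) => i iq.
by rewrite mul_polyC; apply/mem_IntK; exact: (sI (Ordinal iq)).
Qed.

End IntKRing.

Section LocalInt.
Variables (D : idomainType) (A : algType D) (B : algType {fraction D}).
Variable iota : {rmorphism A -> B}.
Hypothesis iota_loc : is_scalar_localization iota.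
Local Notation K := {fraction D}.
Variables (M : prime_idealr D) (V : valuationRing K).
Hypothesis V_local : forall x, x \in V <-> local_ring M x.
Local Notation AM := (localize M (range iota)).
Local Notation IntM := (localize M (IntK (range iota))).

Lemma range_scale (d : D) x : range iota x -> range iota (d%:F *: x).
Proof.
by move=> [a _ <-]; exists (d *: a); rewrite ?(scalar_localizationZ iota_loc).
Qed.

Lemma localize_range_subalgebra : subalgebra_over V AM.
Proof.
split.
- by apply: sub_localize; exists 1; rewrite ?rmorph1.
- apply: localize_add => [d x|_ _ [a _ <-] [b _ <-]]; first exact: range_scale.
  by exists (a + b); rewrite ?rmorphD.
- move=> x y /localizeP[s sM [a _ aE]] /localizeP[t tM [b _ bE]].
  apply/localizeP; exists (s * t); first exact: notin_primeM.
  exists (a * b) => //; rewrite rmorphM aE bE tofracM.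
  by rewrite -scalerAl -scalerAr scalerA.
- by move=> c x /V_local; apply: localize_scale => d y; exact: range_scale.
Qed.

Lemma localize_range_matrix n (g : 'I_n -> A) b :
  (forall x, exists c : 'I_n -> D, x = \sum_(i < n) c i *: g i) -> AM b ->
  exists2 C : 'M[K]_n, forall i j, C i j \in V
    & forall i, b * iota (g i) = \sum_j C i j *: iota (g j).
Proof.
move=> gspan /localizeP[s sM [a _ aE]].
have s0 : s%:F != 0 := notin_prime_neq0 sM.
have /fin_all_exists[c cE] i := gspan (a * g i).
exists (\matrix_(i, j) ((c i j)%:F / s%:F)) => [i j|i].
  rewrite mxE; apply/V_local/local_ringP; exists s => //; exists (c i j).
  by rewrite mulrC divfK.
have -> : b = s%:F^-1 *: iota a by rewrite aE scalerA mulVf // scale1r.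
rewrite -scalerAl -rmorphM cE rmorph_sum scaler_sumr; apply: eq_bigr => j _.
by rewrite (scalar_localizationZ iota_loc) mxE scalerA mulrC.
Qed.

Hypothesis Int_local : IntM = IntK AM.
Hypothesis Int_closed : integrally_closed (IntK_ring iota).

Lemma localize_IntK_of_comp (phi f : {poly K}) :
  phi \is monic -> phi \is a polyOver V -> (1 < size phi)%N ->
  IntK AM (phi \Po f) -> IntM f.
Proof.
move=> phim /polyOverP phiV sphi; rewrite -Int_local => phif.
have IntM_const c : local_ring M c -> IntM c%:P.
  move=> /local_ringP[s sM [d dE]]; apply/IntK_localizeP; exists s => //.
  by rewrite -mul_polyC -polyCM -dE IntK_const.
pose q := map_poly polyC phi - (phi \Po f)%:P.
apply: (localize_IntK_integral iota_loc Int_closed (q := q)).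
- rewrite monicE lead_coefDl ?lead_coef_map ?(monicP phim) //.
  by rewrite size_polyN size_map_poly (leq_ltn_trans (size_polyC_leq1 _)).
- move=> i; rewrite coefB coef_map coefC /=.
  apply: (localize_add (IntK_rangeZ iota_loc) (@IntK_rangeD _ _ _ iota)).
    exact/IntM_const/V_local.
  case: (_ == _); last first.
    by rewrite oppr0; apply: IntM_const; apply/V_local; exact: rpred0.
  rewrite -scaleN1r; apply: (localize_scale (IntK_rangeZ iota_loc)) phif.
  by apply/V_local; rewrite rpredN1.
by rewrite /root hornerD hornerN hornerC subr_eq0.
Qed.

End LocalInt.
(** * Global partitions of unity *)

Lemma Bezout_family (K : fieldType) (I : finType) (F : I -> {poly K}) :
  exists d (a : I -> {poly K}), (forall i, d %| F i) /\ d = \sum_i a i * F i.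
Proof.
suff [d [a [dF dE]]] : exists d (a : I -> {poly K}),
    (forall i, i \in enum I -> d %| F i) /\ d = \sum_i a i * F i.
  by exists d, a; split=> // i; rewrite dF ?mem_enum.
elim: (enum I) => [|i s [d [a [dF dE]]]].
  by exists 0, (fun=> 0); split=> //; rewrite big1 // => i _; rewrite mul0r.
have [[u v] /= uv] := Bezoutp d (F i).
exists (u * d + v * F i), (fun j => u * a j + (if j == i then v else 0)).
split=> [j|].
  rewrite (eqp_dvdl _ uv) inE => /orP[/eqP->|js]; first exact: dvdp_gcdr.
  exact: dvdp_trans (dvdp_gcdl _ _) (dF _ js).
under [RHS]eq_bigr do rewrite mulrDl -mulrA.
rewrite big_split /= -mulr_sumr -dE (bigD1 i) //= eqxx.
by rewrite big1 ?addr0 // => j /negPf->; rewrite mul0r.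
Qed.

Section PartitionIdeal.
Variables (D : idomainType) (A : algType D) (B : algType {fraction D}).
Variable iota : {rmorphism A -> B}.
Variables (I : finType) (F : I -> {poly {fraction D}}).
Local Notation Int := (IntK_pred iota).

(* The intersection with D of the product of the fractional ideal generated by
   the F i and its inverse. *)
Definition partition_ideal : set D :=
  [set s | exists2 Y : I -> {poly {fraction D}},
    \sum_i Y i * F i = (s%:F)%:P & forall i j, Y i * F j \in Int].

Hypothesis iota_loc : is_scalar_localization iota.

Lemma partition_ideal_closed :
  ~ partition_ideal 1 -> idealr_closed [in partition_ideal].
Proof.
move=> I1; split.
- rewrite in_setE; exists (fun=> 0) => [|i j]; last by rewrite mul0r rpred0.
  by rewrite tofrac0 polyC0 big1 // => i _; rewrite mul0r.
- by apply/negP; rewrite in_setE.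
move=> c s t /set_mem[Y YF YI] /set_mem[Z ZF ZI]; apply/mem_set.
exists (fun i => c%:F *: Y i + Z i) => [|i j].
  under eq_bigr do rewrite mulrDl -scalerAl.
  rewrite big_split /= -scaler_sumr YF ZF tofracD tofracM polyCD polyCM.
  by rewrite mul_polyC.
rewrite mulrDl -scalerAl; apply: rpredD; last exact: ZI.
exact: (IntK_scale iota_loc _ (YI i j)).
Qed.

Hypothesis A_fg : finitely_generated A.
Hypothesis Int_closed : integrally_closed (IntK_ring iota).
Variables (M : prime_idealr D) (V : valuationRing {fraction D}).
Variable pi : {fraction D}.
Variables (T : finType) (rep : T -> {fraction D}).
Hypotheses (Vpi : uniformizer V pi) (Vrep : residue_system V rep).
Hypothesis V_local : forall x, x \in V <-> local_ring M x.
Local Notation AM := (localize M (range iota)).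
Hypothesis Int_local : localize M (IntK (range iota)) = IntK AM.

Lemma finitely_generatedS : exists n (g : 'I_n.+1 -> A),
  forall x, exists c : 'I_n.+1 -> D, x = \sum_i c i *: g i.
Proof.
have [[|n] [g gspan]] := A_fg; last by exists n, g.
by have [c /eqP] := gspan 1; rewrite big_ord0 oner_eq0.
Qed.

Lemma localize_IntK_integral_valued n (g : 'I_n.+1 -> A) f :
  (forall x, exists c : 'I_n.+1 -> D, x = \sum_i c i *: g i) ->
  integral_valued V n.+1 f -> localize M (IntK (range iota)) f.
Proof.
move=> gspan f_integral.
have AM_subalgebra := localize_range_subalgebra iota_loc V_local.
have [|phi [phim phiV sphi phif]] :=
    exists_monic_comp_IntK Vpi Vrep AM_subalgebra (n := n.+1) (f := f).
  move=> b /(localize_range_matrix iota_loc V_local gspan)[C CV bC].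
  exists (char_poly (horner_mx C f)); split.
  - exact: char_poly_monic.
  - exact: (char_poly_horner_mx_polyOver Vpi f_integral).
  - exact: size_char_poly.
  have [e eE] := gspan 1.
  apply: (char_poly_annihilates (G := iota \o g) (e := fun i => (e i)%:F)).
    rewrite -(rmorph1 iota) eE rmorph_sum; apply: eq_bigr => i _.
    exact: scalar_localizationZ.
  exact: horner_alg_horner_mx.
exact: (localize_IntK_of_comp iota_loc V_local) phif.
Qed.

Variable a : I -> {poly {fraction D}}.
Hypothesis aF : \sum_i a i * F i = 1.

Lemma partition_ideal_local : exists2 s, s \notin M & partition_ideal s.
Proof.
have [n [g gspan]] := finitely_generatedS.
have [k FV] := uniformizer_clear_denominators Vpi F.
have [l aV] := uniformizer_clear_denominators Vpi a.
have [|Y [YF YO]] := local_partition Vpi Vrep n.+1 (k := l + k) FV aV.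
  transitivity (pi ^+ (l + k) *: \sum_i a i * F i).
    rewrite scaler_sumr; apply: eq_bigr => i _.
    by rewrite -scalerAl -scalerAr scalerA exprD.
  by rewrite aF alg_polyC.
have [s sM sI] := localize_family (IntK_rangeZ iota_loc)
  (fun ij : I * I => localize_IntK_integral_valued gspan (YO ij.1 ij.2)).
exists s => //; exists (fun i => (s%:F * pi ^+ k) *: Y i) => [|i j].
  rewrite -[RHS]mulr1 -YF mulr_sumr; apply: eq_bigr => i _.
  by rewrite mul_polyC -scalerAr scalerA -scalerAl.
apply/mem_IntK; have := sI (i, j).
by rewrite /= -scalerAl -scalerAr scalerA.
Qed.

End PartitionIdeal.

Lemma partition_of_unity (D : idomainType) (A : algType D)
    (B : algType {fraction D}) (iota : {rmorphism A -> B})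
    (I : finType) (F a : I -> {poly {fraction D}}) :
  almost_dedekind D -> finite_residue_fields D ->
  is_scalar_localization iota -> finitely_generated A ->
  (forall P : prime_idealr D,
     localize P (IntK (range iota)) = IntK (localize P (range iota))) ->
  integrally_closed (IntK_ring iota) ->
  \sum_i a i * F i = 1 -> partition_ideal iota F 1.
Proof.
move=> [_ D_dvr] D_fin iota_loc A_fg Int_local Int_closed aF.
apply: contrapT => /(partition_ideal_closed iota_loc) F_closed.
have [M Mmax FM] := exists_maximal_prime_ideal F_closed.
have [v v_norm VvE] := D_dvr M Mmax.
have [V [pi [Vpi V_local]]] := normalized_valuation_uniformizer v_norm.
rewrite -VvE in V_local.
have [T [rep Vrep]] := local_ring_residue_system Mmax V_local (D_fin M Mmax).
have [s sM /FM] := partition_ideal_local iota_loc A_fg Int_closed Vpi Vrep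
  V_local (Int_local M) aF.
exact/negP.
Qed.

Lemma invertible_ideal_gen (R : idomainType) n (G : 'I_n -> R)
    (z : 'I_n -> 'I_n -> R) i0 : G i0 != 0 ->
  (forall i j k, z i j * G k = z i k * G j) -> \sum_i z i i = 1 ->
  invertible_ideal (ideal_gen G).
Proof.
move=> Gi0 zG z1.
have Gi0F : (G i0)%:F != 0 :> {fraction R} by rewrite tofrac_eq0.
set rg := range (@FracField.tofrac R).
have rgD u v : rg u -> rg v -> rg (u + v).
  by move=> [x _ <-] [y _ <-]; exists (x + y); rewrite ?tofracD.
have rgM u v : rg u -> rg v -> rg (u * v).
  by move=> [x _ <-] [y _ <-]; exists (x * y); rewrite ?tofracM.
have rg0 : rg 0 by exists 0; rewrite ?tofrac0.
have rgF (u : R) : rg u%:F by exists u.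
pose y i : {fraction R} := (z i i0)%:F / (G i0)%:F.
have yG i j : y i * (G j)%:F = (z i j)%:F.
  by apply: (mulIf Gi0F); rewrite mulrAC divfK // -!tofracM zG.
exists [set x | forall i, rg (x * (G i)%:F)].
  split.
  - by move=> i; rewrite mul0r.
  - by move=> u v uJ vJ i; rewrite mulrDl; apply: rgD.
  - by move=> u x xJ i; rewrite -mulrA; apply: rgM.
  - by exists (G i0) => // x xJ; rewrite mulrC; exact: xJ.
apply/seteqP; split=> x.
  move=> [m [u [v [uI vJ ->]]]]; apply: (big_ind rg) => // k _.
  have [c ->] := uI k; rewrite rmorph_sum mulr_suml.
  apply: (big_ind rg) => // i _.
  by rewrite rmorphM /= -mulrA [_ * v k]mulrC; apply: rgM => //; exact: vJ.
move=> [u _ <-]; exists n, (fun i => (G i)%:F), (fun i => u%:F * y i); split.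
- move=> i; exists (fun j => (j == i)%:R).
  rewrite (bigD1 i) //= eqxx mul1r big1 ?addr0 // => j /negPf->.
  by rewrite mul0r.
- by move=> i j; rewrite -mulrA yG -tofracM.
- under eq_bigr do rewrite mulrCA [_%:F * y _]mulrC yG.
  by rewrite -mulr_sumr -rmorph_sum z1 rmorph1 mulr1.
Qed.

Theorem theorem1p9 (D : idomainType) (A : algType D)
  (B : algType {fraction D}) (iota : {rmorphism A -> B})
  (hD : ADDB_domain D)
  (htf : torsion_free A) (hfg : finitely_generated A)
  (hB : is_scalar_localization iota)
  (hAK : range iota `&` range (fun k : {fraction D} => k%:A : B)
         = range (fun d : D => d%:F%:A : B))
  (hloc : forall P : prime_idealr D,
     localize P (IntK (range iota)) = IntK (localize P (range iota)))
  (hic : integrally_closed (IntK_ring iota)) :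
  prufer_domain (IntK_ring iota).
Proof.
move=> n G [i0 Gi0]; have [D_ad D_fin _] := hD.
have [d [a [dG dE]]] := Bezout_family (fun i => val (G i)).
have d0 : d != 0.
  apply: contraTneq (dG i0) => ->.
  by rewrite dvd0p -[0](rmorph0 (val : IntK_ring iota -> _)) (inj_eq val_inj).
pose F i := val (G i) %/ d; have GE i : val (G i) = F i * d by rewrite divpK.
have aF : \sum_i a i * F i = 1.
  apply: (mulIf d0); rewrite mul1r [RHS]dE mulr_suml.
  by apply: eq_bigr => i _; rewrite -mulrA -GE.
have [Y + YI] := partition_of_unity D_ad D_fin hB hfg hloc hic aF.
rewrite tofrac1 => YF.
pose z i j : IntK_ring iota := Sub (Y i * F j) (YI i j).
apply: (@invertible_ideal_gen _ _ _ z i0) => // [i j k|]; apply: val_inj.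
  by rewrite !rmorphM /= !GE; ring.
by rewrite rmorph_sum rmorph1; apply: etrans YF; apply: eq_bigr.
Qed.
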